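(* Let $(A,L)$ be an extended complete spectral metric space and $\mathbb{F}=(f_1,\ldots,f_k)$ a dual iterated function system on $A$. Suppose $\pi,\pi'\in\mathring{\Delta}^k$ are such that $\Lambda^1_L(\pi\cdot\mathbb{F}^* )<1$ and $\Lambda^1_L(\pi'\cdot\mathbb{F}^* )<1$. Then for any two states $\phi,\phi'\in\mathcal{S}(A)$ which are $(\pi\cdot\mathbb{F}^* )$-self-similar and $(\pi'\cdot\mathbb{F}^* )$-self-similar respectively, and which satisfy $d_L(\phi,\phi')<\infty$, we have $\overline{\operatorname{supp}}(\phi)=\overline{\operatorname{supp}}(\phi')$.
   Context: Let $A$ be a $C^*$-algebra, $A^{\mathrm{sa}}$ its self-adjoint part, $M(A)$ its multiplier algebra with self-adjoint part $M(A)^{\mathrm{sa}}$, and $A''$ its universal enveloping von Neumann algebra (identified with the second dual; $A\subset M(A)\subset A''$). $\mathcal{S}(A)$ denotes the states of $A$; each extends uniquely to a strictly continuous state of $M(A)$ and to a normal state of $A''$, denoted by the same symbol. An extended complete spectral metric space is a pair $(A,L)$ where $L:A^{\mathrm{sa}}\to[0,\infty]$ is an extended semi-norm such that (1) $\{c\in A^{\mathrm{sa}}: L(c)<\infty\}$ is norm dense in $A^{\mathrm{sa}}$; (2) there is an approximate identity $(I_n)$ of $A$ (a net of positive contractions) with $L(I_n)\to0$; (3) $L$ is norm lower semicontinuous, i.e. $\{b\in A^{\mathrm{sa}}:L(b)\le c\}$ is norm closed for all $c\ge 0$. Put $d_L(\phi,\psi)=\sup\{|\phi(b)-\psi(b)|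 : b\in A^{\mathrm{sa}},L(b)\le1\}\in[0,\infty]$ for $\phi,\psi\in\mathcal{S}(A)$. Standing assumption: for all $b\in A^{\mathrm{sa}}$, $L(b)=\inf\{C>0: |\phi(b)-\psi(b)|\le C\,d_L(\phi,\psi)\ \forall \phi,\psi\in\mathcal{S}(A)\}$. The same formula extends $L$ to $M(A)^{\mathrm{sa}}$. A $*$-homomorphism $f:A\to M(B)$ is relatively proper if there is an increasing approximate identity $(I_n)$ of $A$ with $f(I_n)\to I\in M(B)$ strictly; such $f$ extends uniquely to a unital $*$-homomorphism $M(A)\to M(B)$ that is strictly continuous on the unit ball, also denoted $f$. A dual iterated function system (dual IFS) on $A$ is a finite list $\mathbb{F}=(f_1,\ldots,f_k)$ of relatively proper $*$-homomorphisms $f_i:A\to M(A)$. $\mathring{\Delta}^k=\{(\pi_1,\ldots,\pi_k)\in(0,1)^k:\sum_i\pi_i=1\}$. $(\pi\cdot\mathbb{F}^* )\phi=\sum_{i=1}^k\pi_i\,\phi\circ f_i$, which maps $\mathcal{S}(A)$ to $\mathcal{S}(A)$. A state $\phi\in\mathcal{S}(A)$ is $(\pi\cdot\mathbb{F}^* )$-self-similar if $\phi=(\pi\cdot\mathbb{F}^* )(\phi)$. Dilation factors: $\Lambda_L(f)=\sup\{L(f(b)):b\in A^{\mathrm{sa}},L(b)\le1\}$ and $\Lambda^1_L(\pi\cdot\mathbb{F}^* )=\sum_{i=1}^k\pi_i\Lambda_L(f_i)\in[0,\infty]$. A projection $p\in A''$ is open if there is a net $(a_n)\subset A$ with $0\le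 a_n\nearrow p$ $\sigma$-weakly, and closed if $1-p$ is open. The closure $\overline{p}$ of a projection $p\in A''$ is the smallest closed projection $\ge p$. The support projection $\operatorname{supp}(\phi)$ of $\phi\in\mathcal{S}(A)$ is the infimum of all projections $p\in A''$ with $\phi(p)=1$, and the closed support projection is $\overline{\operatorname{supp}}(\phi)=\overline{\operatorname{supp}(\phi)}$, equivalently the infimum of all closed projections $p\in A''$ with $\phi(p)=1$. *)

(* Defs.v *)
From HB Require Import structures.
From mathcomp Require Import all_boot all_order all_algebra.
From mathcomp Require Import complex.
From mathcomp Require Import all_classical all_reals all_analysis.

Set Implicit Arguments.
Unset Strict Implicit.
Unset Printing Implicit Defensive.

Import Order.TTheory GRing.Theory Num.Theory.
Import numFieldNormedType.Exports.

Local Open Scope classical_set_scope.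
Local Open Scope complex_scope.
Local Open Scope ring_scope.

(* MathComp's algebras are unital, so the product of a possibly non-unital
   C*-algebra is part of the structure. *)
HB.mixin Record isCStarAlgebra (R : realType) A
    of CompleteNormedModule R[i] A := {
  cmul : A -> A -> A ;
  cadj : A -> A ;
  cmulA : associative cmul ;
  cmul_linearl : forall (z : R[i]) a b c,
    cmul (z *: a + b) c = z *: cmul a c + cmul b c ;
  cmul_linearr : forall (z : R[i]) a b c,
    cmul c (z *: a + b) = z *: cmul c a + cmul c b ;
  cadjK : involutive cadj ;
  cadj_antilinear : forall (z : R[i]) a b,
    cadj (z *: a + b) = conjc z *: cadj a + cadj b ;
  cadjM : forall a b, cadj (cmul a b) = cmul (cadj b) (cadj a) ;
  normr_cmul : forall a b, `|cmul a b| <= `|a| * `|b| ;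
  normr_cstar : forall a, `|cmul (cadj a) a| = `|a| ^+ 2
}.

#[short(type="cstarType")]
HB.structure Definition CStarAlgebra (R : realType) :=
  {A of CompleteNormedModule R[i] A & isCStarAlgebra R A}.

(* The inner product is linear in its first argument. *)
HB.mixin Record isHilbertSpace (R : realType) H
    of CompleteNormedModule R[i] H := {
  inner : H -> H -> R[i] ;
  inner_linear : forall (z : R[i]) u v w,
    inner (z *: u + v) w = z * inner u w + inner v w ;
  inner_conj : forall u v, inner u v = conjc (inner v u) ;
  inner_norm : forall u, inner u u = `|u| ^+ 2
}.

#[short(type="hilbertType")]
HB.structure Definition HilbertSpace (R : realType) :=
  {H of CompleteNormedModule R[i] H & isHilbertSpace R H}.

(* Norms of an R[i]-normed space live in R[i]; rnorm x is `|x| as a real. *)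
Definition rnorm (R : realType) (V : normedZmodType R[i]) (x : V) : R :=
  complex.Re `|x|.

Record directed := Directed {
  dcar :> Type ;
  dle : dcar -> dcar -> Prop ;
  dle_refl : forall i, dle i i ;
  dle_trans : forall i j l, dle i j -> dle j l -> dle i l ;
  dle_dir : forall i j, exists l, dle i l /\ dle j l ;
  dcar_inhabited : inhabited dcar
}.

Definition tails (D : directed) : set_system D :=
  [set P | exists i, forall j, dle i j -> P j].
Arguments tails D : clear implicits.

Section Algebra.
Variables (R : realType) (A : cstarType R).
Implicit Types (a b : A) (phi psi : A -> R[i]).

Definition selfadjoint : set A := [set a | cadj a = a].
Definition positive : set A := [set a | exists c, a = cmul (cadj c) c].

Definition state : set (A -> R[i]) := [set phi |
  [/\ scalar phi,
      forall a, positive a -> 0 <= phi a &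
      ereal_sup [set (rnorm (phi a))%:E | a in [set a | rnorm a <= 1]] = 1%E]].

Definition approximate_identity (D : directed) (I : D -> A) : Prop :=
  [/\ forall n, positive (I n) /\ rnorm (I n) <= 1,
      forall a, cmul (I n) a @[n --> tails D] --> a &
      forall a, cmul a (I n) @[n --> tails D] --> a].

Definition increasing (D : directed) (x : D -> A) : Prop :=
  forall m n, dle m n -> positive (x n - x m).

(* An extended semi-norm on the self-adjoint part is given by a function on A
   of which only the values at self-adjoint elements are ever used. *)
Variable L : A -> \bar R.

Definition extended_seminorm : Prop :=
  [/\ forall b, selfadjoint b -> (0 <= L b)%E,
      forall b c, selfadjoint b -> selfadjoint c ->
        (L (b + c)%R <= L b + L c)%E &
      forall (t : R) b, selfadjoint b -> L (t%:C *: b) = (`|t|%:E * L b)%E].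

Definition extended_complete_spectral_metric_space : Prop :=
  [/\ extended_seminorm,
      selfadjoint `<=` closure [set c | selfadjoint c /\ (L c < +oo)%E],
      exists (D : directed) (I : D -> A), approximate_identity I /\
        L (I n) @[n --> tails D] --> 0%E &
      forall c : R, 0 <= c ->
        closed [set b | selfadjoint b /\ (L b <= c%:E)%E]].

Definition state_dist phi psi : \bar R :=
  ereal_sup [set (rnorm (phi b - psi b))%:E |
    b in [set b | selfadjoint b /\ (L b <= 1)%E]].

(* [x phi] is the value at the state phi of the element under consideration. *)
Definition lipschitz_constant (x : (A -> R[i]) -> R[i]) : \bar R :=
  ereal_inf [set C%:E | C in [set C : R | 0 < C /\
    forall phi psi, state phi -> state psi ->
      ((rnorm (x phi - x psi))%:E <= C%:E * state_dist phi psi)%E]].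

Definition metric_determines_seminorm : Prop :=
  forall b, selfadjoint b -> L b = lipschitz_constant (fun phi => phi b).

End Algebra.

Section Operators.
Variables (R : realType) (H : hilbertType R).
Implicit Types S T : H -> H.

Definition bounded_operator : set (H -> H) :=
  [set T | linear T /\ continuous T].

Definition adjoint_pair S T : Prop := forall u v, inner (S u) v = inner u (T v).

Definition operator_le S T : Prop :=
  forall u, inner (S u) u <= inner (T u) u.

Definition operator_norm T : \bar R :=
  ereal_sup [set (rnorm (T u))%:E | u in [set u | rnorm u <= 1]].

Definition commutant (X : set (H -> H)) : set (H -> H) :=
  [set T | bounded_operator T /\ forall S, X S -> T \o S = S \o T].

Definition square_summable (xi : nat -> H) : Prop :=
  cvgn (series (fun n => rnorm (xi n) ^+ 2)).

Definition sigma_weak_cvg (D : directed) (T : D -> H -> H) S : Prop :=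
  forall xi eta : nat -> H, square_summable xi -> square_summable eta ->
    (limn (series (fun n => inner (T d (xi n) - S (xi n)) (eta n) : R[i]^o))
       : R[i]^o)
    @[d --> tails D] --> (0 : R[i]^o).

End Operators.

(* The universal representation of A: up to unitary equivalence, the direct sum
   over all states phi of the GNS representations of phi, with cyclic vectors
   uvec phi (whose value is irrelevant when phi is not a state). *)
Record universal_rep (R : realType) (A : cstarType R) := UniversalRep {
  uspace :> hilbertType R ;
  urep : A -> uspace -> uspace ;
  urep_bounded : forall a, bounded_operator (urep a) ;
  urep_linear : forall (z : R[i]) a b u,
    urep (z *: a + b) u = z *: urep a u + urep b u ;
  urepM : forall a b, urep (cmul a b) = urep a \o urep b ;
  urep_adj : forall a, adjoint_pair (urep a) (urep (cadj a)) ;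
  uvec : (A -> R[i]) -> uspace ;
  uvec_gns : forall phi, state phi ->
    forall a, phi a = inner (urep a (uvec phi)) (uvec phi) ;
  uvec_orthogonal : forall phi psi, state phi -> state psi -> phi <> psi ->
    forall a b, inner (urep a (uvec phi)) (urep b (uvec psi)) = 0 ;
  uvec_total : forall v,
    (forall phi a, state phi -> inner (urep a (uvec phi)) v = 0) -> v = 0
}.
Arguments urep {R A} _ _ _.
Arguments uvec {R A} _ _.

Section Enveloping.
Variables (R : realType) (A : cstarType R) (U : universal_rep A).
Implicit Types (phi psi : A -> R[i]) (p q s T : U -> U).

(* The enveloping von Neumann algebra is the bicommutant of A in its universal
   representation, and the multiplier algebra is the idealizer of A in it. *)
Definition enveloping : set (U -> U) :=
  commutant (commutant (range (urep U))).

Definition multiplier : set (U -> U) :=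
  [set T | enveloping T /\ forall b,
    range (urep U) (T \o urep U b) /\ range (urep U) (urep U b \o T)].

(* The normal extension of the state phi to the enveloping algebra, hence also
   its strictly continuous extension to the multiplier algebra. *)
Definition normal_ext phi T : R[i] := inner (T (uvec U phi)) (uvec U phi).

Definition multiplier_seminorm (L : A -> \bar R) T : \bar R :=
  lipschitz_constant L (fun phi => normal_ext phi T).

Definition strict_cvg (D : directed) (T : D -> U -> U) (S : U -> U) : Prop :=
  forall b,
    operator_norm (fun u => T n (urep U b u) - S (urep U b u))
      @[n --> tails D] --> 0%E /\
    operator_norm (fun u => urep U b (T n u) - urep U b (S u))
      @[n --> tails D] --> 0%E.

Definition star_hom (f : A -> U -> U) : Prop :=
  [/\ forall a, multiplier (f a),
      forall (z : R[i]) a b u, f (z *: a + b) u = z *: f a u + f b u,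
      forall a b, f (cmul a b) = f a \o f b &
      forall a, adjoint_pair (f a) (f (cadj a))].

Definition relatively_proper (f : A -> U -> U) : Prop :=
  exists (D : directed) (I : D -> A),
    [/\ approximate_identity I, increasing I &
        strict_cvg (fun n => f (I n)) id].

Definition dual_ifs (k : nat) (f : 'I_k -> A -> U -> U) : Prop :=
  forall i, star_hom (f i) /\ relatively_proper (f i).

Definition open_simplex (k : nat) : set ('I_k -> R) :=
  [set w | (forall i, 0 < w i < 1) /\ \sum_(i < k) w i = 1].

Definition ifs_action (k : nat) (w : 'I_k -> R) (f : 'I_k -> A -> U -> U) phi :
    A -> R[i] :=
  fun a => \sum_(i < k) (w i)%:C * normal_ext phi (f i a).

Definition self_similar (k : nat) (w : 'I_k -> R) (f : 'I_k -> A -> U -> U)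
    phi : Prop :=
  phi = ifs_action w f phi.

Definition dilation (L : A -> \bar R) (f : A -> U -> U) : \bar R :=
  ereal_sup [set multiplier_seminorm L (f b) |
    b in [set b | selfadjoint b /\ (L b <= 1)%E]].

Definition mean_dilation (L : A -> \bar R) (k : nat) (w : 'I_k -> R)
    (f : 'I_k -> A -> U -> U) : \bar R :=
  (\sum_(i < k) (w i)%:E * dilation L (f i))%E.

Definition projection : set (U -> U) :=
  [set p | [/\ enveloping p, adjoint_pair p p & p \o p = p]].

Definition open_projection : set (U -> U) :=
  [set p | projection p /\ exists (D : directed) (x : D -> A),
    [/\ forall n, positive (x n), increasing x &
        sigma_weak_cvg (fun n => urep U (x n)) p]].

Definition closed_projection : set (U -> U) :=
  [set p | projection p /\ open_projection (fun u => u - p u)].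

(* Infima of sets of projections, in the projection lattice. *)
Definition is_proj_inf (X : set (U -> U)) p : Prop :=
  [/\ projection p, forall q, X q -> operator_le p q &
      forall s, projection s -> (forall q, X q -> operator_le s q) ->
        operator_le s p].

Definition is_proj_closure p q : Prop :=
  [/\ closed_projection q, operator_le p q &
      forall s, closed_projection s -> operator_le p s -> operator_le q s].

(* The objects described by is_proj_inf and is_proj_closure exist and are
   unique; the default value 0 of xget plays no role. *)
Definition proj_closure p : U -> U :=
  xget (fun=> 0) [set q | is_proj_closure p q].

Definition supp phi : U -> U :=
  xget (fun=> 0)
    [set p | is_proj_inf [set q | projection q /\ normal_ext phi q = 1] p].

Definition closed_supp phi : U -> U := proj_closure (supp phi).

End Enveloping.
Arguments normal_ext {R A} U phi T.
Arguments supp {R A} U phi.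
Arguments closed_supp {R A} U phi.

(* Main.v *)
Require Import Defs.
From mathcomp Require Import all_boot all_order all_algebra.
From mathcomp Require Import complex.
From mathcomp Require Import all_classical all_reals all_analysis.
From mathcomp Require Import ring lra.

(** Let [T = ifs_action w f], a strict contraction for [state_dist L] that fixes
   [phi]; as [state_dist L phi phi'] is finite, the iterates [T^n phi'] converge
   to [phi] on the norm-dense set where [L] is finite, hence pointwise. Since
   [phi'] is self-similar with positive weights [w'], a positive element
   annihilated by [phi'] is annihilated by every [phi' \o f i]; so each
   [T^n phi'], and in the limit [phi], vanishes on the positive elements that
   [phi'] annihilates. An open projection is a limit of positive elements of [A]
   below it, so every closed projection carrying [phi'] carries [phi]. Exchanging
   the two states, [phi] and [phi'] are carried by the same closed projections. *)

Set Implicit Arguments.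
Unset Strict Implicit.
Unset Printing Implicit Defensive.

Import Order.TTheory GRing.Theory Num.Theory.
Import numFieldNormedType.Exports.

Local Open Scope classical_set_scope.
Local Open Scope complex_scope.
Local Open Scope ring_scope.

Local Notation Re := complex.Re.

(** * Real-valued norms and inner products *)

(** The null ideal of a state is handled through its cyclic vector: [a] belongs to it when
    [urep U a] kills [uvec U phi]. In this form domination between null ideals extends from [A] to
    multipliers, as it must, since each [f i a] is only a multiplier. The metric compares states
    only, so the iterates must be shown to be states. This rests on contractivity of
    *-homomorphisms, on cyclic vectors having norm one, and on [f i (J l) xi] tending to [xi].
    Contractivity is drawn from the C*-identity by a square root iteration inside [A], free of a
    unit and of spectral theory. As [supp] is a choice, its value means something only once the
    infimum exists; this is why orthogonal projections and adjoints are built. *)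

Section RealNorm.
Variables (R : realType) (V : normedZmodType R[i]).
Implicit Types x y t : V.

Lemma norm_rnorm x : `|x| = (rnorm x)%:C.
Proof. by rewrite /rnorm RRe_real// ger0_real. Qed.

Lemma rnorm_ge0 x : 0 <= rnorm x.
Proof. by rewrite -ler0c -norm_rnorm. Qed.

Lemma rnorm0 : rnorm (0 : V) = 0.
Proof. by apply: complexI; rewrite -norm_rnorm normr0. Qed.

Lemma rnorm_eq0 x : rnorm x = 0 -> x = 0.
Proof. by move=> x0; apply/normr0_eq0; rewrite norm_rnorm x0. Qed.

Lemma rnorm_gt0 x : x != 0 -> 0 < rnorm x.
Proof.
move=> x0; rewrite lt_neqAle rnorm_ge0 andbT eq_sym.
by apply: contra_neq x0 => /rnorm_eq0.
Qed.

Lemma rnormN x : rnorm (- x) = rnorm x.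
Proof. by rewrite /rnorm normrN. Qed.

Lemma rnormBC x y : rnorm (x - y) = rnorm (y - x).
Proof. by rewrite /rnorm distrC. Qed.

Lemma rnormD x y : rnorm (x + y) <= rnorm x + rnorm y.
Proof. by rewrite -lecR raddfD/= -!norm_rnorm ler_normD. Qed.

Lemma rnormB x y : rnorm (x - y) <= rnorm x + rnorm y.
Proof. by rewrite -(rnormN y) rnormD. Qed.

Lemma rnorm_triangle x y t : rnorm (x - t) <= rnorm (x - y) + rnorm (y - t).
Proof. by have := rnormD (x - y) (y - t); rewrite addrA addrNK. Qed.

Lemma rnorm_small x : (forall e : R, 0 < e -> rnorm x <= e) -> x = 0.
Proof.
move=> x0; apply: rnorm_eq0; apply/eqP; rewrite eq_le rnorm_ge0 andbT.
by apply/ler_addgt0Pr => e /x0; rewrite add0r.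
Qed.

End RealNorm.

Lemma rnormZ (R : realType) (V : normedModType R[i]) (z : R[i]) (x : V) :
  rnorm (z *: x) = rnorm z * rnorm x.
Proof. by apply: complexI; rewrite rmorphM/= -!norm_rnorm normrZ. Qed.

Section ComplexNorm.
Variable R : realType.
Implicit Types z t : R[i].

Lemma rnormM z t : rnorm (z * t) = rnorm z * rnorm t.
Proof. by apply: complexI; rewrite rmorphM/= -!norm_rnorm normrM. Qed.

Lemma rnorm_real (r : R) : rnorm r%:C = `|r|.
Proof. by rewrite /rnorm normc_def/= expr0n/= addr0 sqrtr_sqr. Qed.

Lemma normRe_le z : `|Re z| <= rnorm z.
Proof. by rewrite -lecR -norm_rnorm normc_ge_Re. Qed.

Lemma Re_le_rnorm z : Re z <= rnorm z.
Proof. exact: le_trans (ler_norm _) (normRe_le z). Qed.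

Lemma sqr_rnormC z : rnorm z ^+ 2 = Re z ^+ 2 + complex.Im z ^+ 2.
Proof. by apply: complexI; rewrite add_Re2_Im2 norm_rnorm rmorphXn. Qed.

Lemma Re_conjM_self (r : R) z : Re (conjc (r%:C * z) * z) = r * rnorm z ^+ 2.
Proof. by rewrite sqr_rnormC; case: z => a b /=; ring. Qed.

Lemma Re_realM (r : R) z : Re (r%:C * z) = r * Re z.
Proof. by case: z => a b /=; rewrite mul0r subr0. Qed.

Lemma Re_conjc z : Re (conjc z) = Re z.
Proof. by case: z. Qed.

End ComplexNorm.

Section InnerProduct.
Variables (R : realType) (H : hilbertType R).
Implicit Types (u v w : H) (z : R[i]).

Lemma innerDl u v w : inner (u + v) w = inner u w + inner v w.
Proof. by rewrite -[u]scale1r inner_linear mul1r scale1r. Qed.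

Lemma inner0l w : inner 0 w = 0.
Proof. by apply: (addrI (inner 0 w)); rewrite -innerDl !addr0. Qed.

Lemma innerZl z u w : inner (z *: u) w = z * inner u w.
Proof. by rewrite -[z *: u]addr0 inner_linear inner0l addr0. Qed.

Lemma innerNl u w : inner (- u) w = - inner u w.
Proof. by rewrite -scaleN1r innerZl mulN1r. Qed.

Lemma innerBl u v w : inner (u - v) w = inner u w - inner v w.
Proof. by rewrite innerDl innerNl. Qed.

Lemma innerDr u v w : inner w (u + v) = inner w u + inner w v.
Proof. by rewrite inner_conj innerDl rmorphD/= -!inner_conj. Qed.

Lemma inner0r w : inner w 0 = 0.
Proof. by rewrite inner_conj inner0l conjc0. Qed.

Lemma innerZr z u w : inner w (z *: u) = conjc z * inner w u.
Proof. by rewrite inner_conj innerZl rmorphM/= -inner_conj. Qed.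

Lemma innerNr u w : inner w (- u) = - inner w u.
Proof. by rewrite inner_conj innerNl rmorphN/= -inner_conj. Qed.

Lemma innerBr u v w : inner w (u - v) = inner w u - inner w v.
Proof. by rewrite innerDr innerNr. Qed.

Lemma inner_rnorm u : inner u u = (rnorm u ^+ 2)%:C.
Proof. by rewrite inner_norm norm_rnorm rmorphXn. Qed.

Lemma inner_ge0 u : 0 <= inner u u.
Proof. by rewrite inner_rnorm ler0c sqr_ge0. Qed.

Lemma sqr_rnormB u v :
  rnorm (u - v) ^+ 2 = rnorm u ^+ 2 + rnorm v ^+ 2 - 2 * Re (inner u v).
Proof.
have := inner_rnorm (u - v).
rewrite innerBl !innerBr (inner_conj v u) !inner_rnorm => /(congr1 (@Re R)).
by case: (inner u v) => a b /= <-; ring.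
Qed.

Lemma sqr_rnormD u v :
  rnorm (u + v) ^+ 2 = rnorm u ^+ 2 + rnorm v ^+ 2 + 2 * Re (inner u v).
Proof.
by rewrite -[v in LHS]opprK sqr_rnormB rnormN innerNr raddfN/=; ring.
Qed.

(** Pythagoras: the left side is the squared distance from [u] to the line spanned by [v]. It serves
    both Cauchy-Schwarz and the orthogonality of minimisers. *)
Lemma sqr_rnorm_proj u v : v != 0 ->
  rnorm (u - ((rnorm v ^- 2)%:C * inner u v) *: v) ^+ 2 =
  rnorm u ^+ 2 - (rnorm (inner u v) / rnorm v) ^+ 2.
Proof.
move=> v0; have r0 : rnorm v != 0 by rewrite gt_eqF// rnorm_gt0.
rewrite sqr_rnormB innerZr rnormZ Re_conjM_self rnormM rnorm_real.
by rewrite ger0_norm ?invr_ge0 ?sqr_ge0//; field.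
Qed.

Lemma cauchy_schwarz u v : rnorm (inner u v) <= rnorm u * rnorm v.
Proof.
have [->|v0] := eqVneq v 0.
  by rewrite inner0r !rnorm0 mulr0.
have v_gt0 : 0 < rnorm v by exact: rnorm_gt0.
rewrite -ler_pdivrMr// -ler_sqr ?nnegrE ?divr_ge0 ?rnorm_ge0//.
by rewrite -subr_ge0 -sqr_rnorm_proj// sqr_ge0.
Qed.

Lemma inner_inj u v : (forall w, inner w u = inner w v) -> u = v.
Proof.
move=> uv; apply: subr0_eq; apply: rnorm_eq0; apply/eqP.
have := inner_rnorm (u - v); rewrite innerBr uv subrr.
by move=> /(congr1 (@Re R))/=/esym/eqP; rewrite sqrf_eq0.
Qed.

End InnerProduct.

(** * Square roots in C*-algebras and contractivity of *-representations *)

Section Nets.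
Variable R : realType.

Global Instance tails_filter (D : directed) : ProperFilter (tails D).
Proof.
split=> [[i /(_ i (dle_refl i))]//|].
split=> [|P Q [i iP] [j jQ]|P Q PQ [i iP]].
- by have [j] := dcar_inhabited D; exists j.
- have [l [il jl]] := dle_dir i j; exists l => m lm; split.
    exact: iP (dle_trans il lm).
  exact: jQ (dle_trans jl lm).
- by exists i => j ij; apply: PQ; apply: iP.
Qed.

(** A positive element of [R[i]] is real, so tolerances may be taken in [R]. *)
Lemma cvg_rnormP (V : normedModType R[i]) (T : Type) (F : set_system T)
    (FF : Filter F) (f : T -> V) (l : V) :
  f x @[x --> F] --> l <->
  forall e : R, 0 < e -> \forall x \near F, rnorm (l - f x) < e.
Proof.
split=> [/cvgrPdist_lt fl e e0|fl].
  have e0' : 0 < e%:C :> R[i] by rewrite ltcR.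
  by apply: filterS (fl _ e0') => x; rewrite norm_rnorm ltcR.
apply/cvgrPdist_lt => e e0.
have eE : e = (Re e)%:C by rewrite RRe_real// gtr0_real.
rewrite eE ltcR in e0 *.
by apply: filterS (fl _ e0) => x; rewrite norm_rnorm ltcR.
Qed.

Lemma near_rnorm (V : normedModType R[i]) (u : V) (e : R) :
  0 < e -> \forall v \near u, rnorm (u - v) < e.
Proof. by move: e; apply/cvg_rnormP/cvg_id. Qed.

Lemma cauchy_rnorm_cvg (V : completeNormedModType R[i]) (T : Type)
    (F : set_system T) (FF : ProperFilter F) (f : T -> V) :
  (forall e : R, 0 < e ->
    exists l : V, \forall x \near F, rnorm (l - f x) < e) ->
  exists l : V, f x @[x --> F] --> l.
Proof.
move=> fC; apply/cvg_ex/cauchy_cvgP; apply: cauchy_exP => e e0.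
have eE : e = (Re e)%:C by rewrite RRe_real// gtr0_real.
rewrite eE ltcR in e0 *.
have [l fl] := fC _ e0; exists l.
by apply: filterS fl => x; rewrite -ball_normE /= norm_rnorm ltcR.
Qed.

End Nets.

Section CStarBasics.
Variables (R : realType) (A : cstarType R).
Implicit Types (a b c x : A) (z : R[i]).

Lemma cmulDl a b c : cmul (a + b) c = cmul a c + cmul b c.
Proof. by rewrite -[a]scale1r cmul_linearl !scale1r. Qed.

Lemma cmul0l c : cmul (0 : A) c = 0.
Proof. by apply: (addrI (cmul 0 c)); rewrite -cmulDl !addr0. Qed.

Lemma cmulZl z a c : cmul (z *: a) c = z *: cmul a c.
Proof. by rewrite -[z *: a]addr0 cmul_linearl cmul0l addr0. Qed.

Lemma cmulDr a b c : cmul c (a + b) = cmul c a + cmul c b.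
Proof. by rewrite -[a]scale1r cmul_linearr !scale1r. Qed.

Lemma cmul0r c : cmul c (0 : A) = 0.
Proof. by apply: (addrI (cmul c 0)); rewrite -cmulDr !addr0. Qed.

Lemma cmulZr z a c : cmul c (z *: a) = z *: cmul c a.
Proof. by rewrite -[z *: a]addr0 cmul_linearr cmul0r addr0. Qed.

Lemma cmulNl a c : cmul (- a) c = - cmul a c.
Proof. by rewrite -scaleN1r cmulZl scaleN1r. Qed.

Lemma cmulNr a c : cmul c (- a) = - cmul c a.
Proof. by rewrite -scaleN1r cmulZr scaleN1r. Qed.

Lemma cadjD a b : cadj (a + b) = cadj a + cadj b.
Proof. by rewrite -[a]scale1r cadj_antilinear conjc1 !scale1r. Qed.

Lemma cadj0 : cadj (0 : A) = 0.
Proof. by apply: (addrI (cadj 0)); rewrite -cadjD !addr0. Qed.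

Lemma cadjZ z a : cadj (z *: a) = conjc z *: cadj a.
Proof. by rewrite -[z *: a]addr0 cadj_antilinear cadj0 addr0. Qed.

Lemma cadjN a : cadj (- a) = - cadj a.
Proof. by rewrite -scaleN1r cadjZ rmorphN rmorph1 scaleN1r. Qed.

Lemma rnorm_cmul a b : rnorm (cmul a b) <= rnorm a * rnorm b.
Proof. by rewrite -lecR rmorphM/= -!norm_rnorm normr_cmul. Qed.

Lemma rnorm_cstar a : rnorm (cmul (cadj a) a) = rnorm a ^+ 2.
Proof. by apply: complexI; rewrite rmorphXn/= -!norm_rnorm normr_cstar. Qed.

(** The C*-identity and submultiplicativity give [|b|^2 <= |b^*| |b|], where [|b|] cancels;
    involutivity gives the converse. *)
Lemma rnorm_cadj a : rnorm (cadj a) = rnorm a.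
Proof.
suff le b : rnorm b <= rnorm (cadj b).
  by apply/eqP; rewrite eq_le le -{2}[a]cadjK le.
have := rnorm_cmul (cadj b) b; rewrite rnorm_cstar expr2.
have [b0|b0 _] := ltP 0 (rnorm b); first by rewrite ler_pM2r.
exact: le_trans b0 (rnorm_ge0 _).
Qed.

Lemma selfadjoint_sqr a : selfadjoint (cmul (cadj a) a).
Proof. by rewrite /selfadjoint/= cadjM cadjK. Qed.

Lemma positive_selfadjoint a : positive a -> selfadjoint a.
Proof. by case=> c ->; exact: selfadjoint_sqr. Qed.

Lemma cmul_sqrB a b :
  cmul a a - cmul b b = cmul a (a - b) + cmul (a - b) b.
Proof. by rewrite cmulDr cmulDl cmulNr cmulNl addrA addrNK. Qed.

(* The iteration g |-> (x + g^2) / 2 contracts the ball of radius |x| < 1; its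
   fixed point is 1 - sqrt (1 - x). *)
Fixpoint sqrt_iter x (n : nat) : A :=
  if n is m.+1 then (2^-1 : R)%:C *: (x + cmul (sqrt_iter x m) (sqrt_iter x m))
  else 0.

Lemma rnorm_halfZ a : rnorm ((2^-1 : R)%:C *: a) = 2^-1 * rnorm a.
Proof. by rewrite rnormZ rnorm_real ger0_norm. Qed.

Lemma sqrt_iter_le x n : rnorm x <= 1 -> rnorm (sqrt_iter x n) <= rnorm x.
Proof.
move=> x1; elim: n => [|n IH] /=; first by rewrite rnorm0 rnorm_ge0.
rewrite rnorm_halfZ; have := rnormD x (cmul (sqrt_iter x n) (sqrt_iter x n)).
have := rnorm_cmul (sqrt_iter x n) (sqrt_iter x n).
have := rnorm_ge0 (sqrt_iter x n); nra.
Qed.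

Lemma sqrt_iter_selfadjoint x n : selfadjoint x -> selfadjoint (sqrt_iter x n).
Proof.
rewrite /selfadjoint/= => xs; elim: n => [|n IH] /=; first exact: cadj0.
by rewrite cadjZ cadjD cadjM IH xs conjc_real.
Qed.

(** The difference of squares is a sum of two products, each with a factor of norm at most
    [rnorm x]; the one half absorbs their number. *)
Lemma sqrt_iter_contract x n m : rnorm x <= 1 ->
  rnorm (sqrt_iter x n.+1 - sqrt_iter x m.+1) <=
  rnorm x * rnorm (sqrt_iter x n - sqrt_iter x m).
Proof.
move=> x1 /=; rewrite -scalerBr rnorm_halfZ opprD addrACA subrr add0r cmul_sqrB.
set a := sqrt_iter x n; set b := sqrt_iter x m.
have an : rnorm a <= rnorm x by exact: sqrt_iter_le.
have bn : rnorm b <= rnorm x by exact: sqrt_iter_le.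
have := rnormD (cmul a (a - b)) (cmul (a - b) b).
have := rnorm_cmul a (a - b); have := rnorm_cmul (a - b) b.
have := rnorm_ge0 (a - b); nra.
Qed.

Lemma sqrt_iter_cauchy x n m : rnorm x <= 1 ->
  rnorm (sqrt_iter x n - sqrt_iter x (n + m)) <= rnorm x ^+ n.
Proof.
move=> x1; elim: n => [|n IH].
  by rewrite expr0 /= sub0r rnormN (le_trans (sqrt_iter_le _ x1)).
rewrite addSn (le_trans (sqrt_iter_contract _ _ x1))// exprS.
by rewrite ler_wpM2l ?rnorm_ge0.
Qed.

(** The equation says [1 - x = (1 - g)^2], written without the unit that [A] may lack. *)
Lemma sqrt_exists x : selfadjoint x -> rnorm x < 1 ->
  exists2 g, selfadjoint g & x = g + g - cmul g g.
Proof.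
move=> xs x1.
have [g gl] : exists g : A, sqrt_iter x n @[n --> \oo] --> g.
  apply: (@cauchy_rnorm_cvg R A nat \oo _ (sqrt_iter x)) => e e0.
  have : `|rnorm x| < 1 by rewrite ger0_norm ?rnorm_ge0.
  move=> /(cvg_geometric 1)/cvgrPdist_lt/(_ e e0)[n _ nP].
  exists (sqrt_iter x n); exists n => // m /= nm.
  rewrite -(subnKC nm) (le_lt_trans (sqrt_iter_cauchy _ _ (ltW x1)))//.
  have := nP n (leqnn n); rewrite /= sub0r normrN mul1r.
  exact: le_lt_trans (ler_norm _).
move/cvg_rnormP: gl => gl.
exists g; rewrite /selfadjoint/=.
  apply: subr0_eq; apply: rnorm_small => e e0.
  have e20 : 0 < e / 2 by rewrite divr_gt0.
  have [n _ /(_ n (leqnn n)) /= gn] := gl _ e20.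
  have -> : cadj g - g = cadj (g - sqrt_iter x n) - (g - sqrt_iter x n).
    rewrite cadjD cadjN (sqrt_iter_selfadjoint n xs) opprB addrA.
    by rewrite addrNK.
  by have := rnormB (cadj (g - sqrt_iter x n)) (g - sqrt_iter x n);
    rewrite rnorm_cadj; lra.
apply: subr0_eq; apply: rnorm_small => e e0.
(* Replacing [g] by the iterates costs [2 d] for the linear part and, as [rnorm q <= 1], at most
   [(rnorm g + 1) d] for the square. *)
pose d := e / (4 + rnorm g).
have g0 := rnorm_ge0 g.
have d0 : 0 < d by rewrite divr_gt0//; lra.
have [n _ nP] := gl _ d0.
have gn := nP n (leqnn n); have gm := nP n.+1 (leqnSn n); rewrite /= in gn.
have xE : x = sqrt_iter x n.+1 + sqrt_iter x n.+1 -
    cmul (sqrt_iter x n) (sqrt_iter x n).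
  rewrite /= -scalerDl -raddfD/= (_ : 2^-1 + 2^-1 = 1 :> R); last by field.
  by rewrite scale1r addrK.
have := xE.
move: (sqrt_iter x n.+1) (sqrt_iter x n) (sqrt_iter_le n (ltW x1)) gn gm.
move=> p q q1 gq gp ->.
have -> : p + p - cmul q q - (g + g - cmul g g) =
    (p - g) + (p - g) + (cmul g (g - q) + cmul (g - q) q).
  rewrite -cmul_sqrB !opprD !opprK (addrACA p (- g)) [LHS]addrACA.
  by rewrite (addrC (- cmul q q)).
have := rnormD (p - g + (p - g)) (cmul g (g - q) + cmul (g - q) q).
have := rnormD (p - g) (p - g).
have := rnormD (cmul g (g - q)) (cmul (g - q) q).
have := rnorm_cmul g (g - q); have := rnorm_cmul (g - q) q.
rewrite [rnorm (p - g)]rnormBC.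
have dE : d * (4 + rnorm g) = e by rewrite /d mulfVK// gt_eqF//; lra.
have := rnorm_ge0 (g - q); have := rnorm_ge0 q; nra.
Qed.

End CStarBasics.

Section StarRepresentation.
Variables (R : realType) (A : cstarType R) (H : hilbertType R).
Variable rho : A -> H -> H.
Hypothesis rho_linear :
  forall (z : R[i]) a b u, rho (z *: a + b) u = z *: rho a u + rho b u.
Hypothesis rhoM : forall a b, rho (cmul a b) = rho a \o rho b.
Hypothesis rho_adj : forall a, adjoint_pair (rho a) (rho (cadj a)).
Implicit Types (a b : A) (u v : H).

Lemma star_repD a b u : rho (a + b) u = rho a u + rho b u.
Proof. by rewrite -[a]scale1r rho_linear !scale1r. Qed.

Lemma star_rep0 u : rho 0 u = 0.
Proof. by apply: (addrI (rho 0 u)); rewrite -star_repD !addr0. Qed.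

Lemma star_repZ (z : R[i]) a u : rho (z *: a) u = z *: rho a u.
Proof. by rewrite -[z *: a]addr0 rho_linear star_rep0 addr0. Qed.

Lemma star_repB a b u : rho (a - b) u = rho a u - rho b u.
Proof. by rewrite star_repD -scaleN1r star_repZ scaleN1r. Qed.

Lemma star_rep_sqr a u :
  inner (rho (cmul (cadj a) a) u) u = (rnorm (rho a u) ^+ 2)%:C.
Proof. by rewrite rhoM /= rho_adj cadjK inner_rnorm. Qed.

(* If x = 2 g - g^2 with g self-adjoint, then 1 - rho x = (1 - rho g)^2 >= 0. *)
Lemma star_rep_contractive a u : rnorm (rho a u) <= rnorm a * rnorm u.
Proof.
(* [sqrt_exists] wants norm strictly below 1, so [a^* a] is scaled by [t ^- 2] with [t] above
   [rnorm a]; then [t] is lowered to [rnorm a]. *)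
suff le (t : R) : rnorm a < t -> rnorm (rho a u) <= t * rnorm u.
  have [u0|u0] := leP (rnorm u) 0.
  have u00 : rnorm u = 0 by apply/eqP; rewrite eq_le u0 rnorm_ge0.
    have : rnorm a < rnorm a + 1 by rewrite ltrDl.
  by move=> /le; rewrite u00 !mulr0.
  rewrite -ler_pdivrMr//; apply/ler_addgt0Pr => e e0.
  by rewrite ler_pdivrMr// le// ltrDl.
move=> at_; have t0 : 0 < t by exact: le_lt_trans (rnorm_ge0 a) at_.
have t20 : 0 < t ^- 2 by rewrite invr_gt0 exprn_gt0.
pose x := (t ^- 2)%:C *: cmul (cadj a) a.
have xs : selfadjoint x.
  by rewrite /selfadjoint/= cadjZ selfadjoint_sqr conjc_real.
have x1 : rnorm x < 1.
  rewrite rnormZ rnorm_real gtr0_norm// rnorm_cstar.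
  rewrite mulrC ltr_pdivrMr ?exprn_gt0// mul1r ltr_sqr// nnegrE ?rnorm_ge0//.
  exact: ltW.
have [g gs xE] := sqrt_exists xs x1.
have gE : inner (rho (cmul g g) u) u = (rnorm (rho g u) ^+ 2)%:C.
  by rewrite -{1}gs star_rep_sqr.
have := sqr_ge0 (rnorm (u - rho g u)); rewrite sqr_rnormB.
have : inner (rho x u) u =
    inner (rho g u) u + inner (rho g u) u - (rnorm (rho g u) ^+ 2)%:C.
  by rewrite xE star_repB star_repD innerBl innerDl gE.
rewrite {1}/x star_repZ innerZl star_rep_sqr -rmorphM/= => /(congr1 (@Re R)).
rewrite (inner_conj u) Re_conjc raddfB raddfD/= => h1 h2.
have h : t ^- 2 * rnorm (rho a u) ^+ 2 <= rnorm u ^+ 2 by lra.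
move: h; rewrite mulrC ler_pdivrMr ?exprn_gt0// -exprMn ler_sqr.
- by rewrite mulrC.
- by rewrite nnegrE rnorm_ge0.
- by rewrite nnegrE mulr_ge0 ?rnorm_ge0// ltW.
Qed.

End StarRepresentation.

(** * Orthogonal projections and adjoints in Hilbert spaces *)

Section BoundedOperators.
Variables (R : realType) (H : hilbertType R).
Implicit Types (u v w : H) (S T : H -> H).

Lemma linear_op0 T : linear T -> T 0 = 0.
Proof. by move=> Tl; have := Tl (-1) 0 0; rewrite scaler0 addr0 scaleN1r addNr. Qed.

Lemma linear_opZ T z u : linear T -> T (z *: u) = z *: T u.
Proof. by move=> Tl; rewrite -[z *: u]addr0 Tl linear_op0// addr0. Qed.

Lemma linear_opD T u v : linear T -> T (u + v) = T u + T v.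
Proof. by move=> Tl; rewrite -[u]scale1r Tl !scale1r. Qed.

Lemma linear_opB T u v : linear T -> T (u - v) = T u - T v.
Proof. by move=> Tl; rewrite linear_opD// -scaleN1r linear_opZ// scaleN1r. Qed.

Lemma bounded_operatorP T : bounded_operator T <->
  linear T /\ exists C : R, forall u, rnorm (T u) <= C * rnorm u.
Proof.
split=> [[Tl Tc]|[Tl [C TC]]]; split=> //.
  have /cvg_rnormP/(_ 1 ltr01) := Tc 0.
  rewrite linear_op0// => /nbhs_ballP[d /= d0 dT].
  have dE : d = (Re d)%:C by rewrite RRe_real// gtr0_real.
  rewrite dE ltcR in d0; set r := Re d in d0 dE.
  exists (2 / r) => u; have [->|u0] := eqVneq u 0.
    by rewrite linear_op0// !rnorm0 mulr0.
  have u_gt0 : 0 < rnorm u by exact: rnorm_gt0.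
  pose t := r / (2 * rnorm u).
  have t0 : 0 < t by rewrite divr_gt0// mulr_gt0.
  have := dT (t%:C *: u).
  rewrite -ball_normE /= sub0r normrN norm_rnorm dE ltcR rnormZ rnorm_real.
  rewrite sub0r rnormN linear_opZ// rnormZ rnorm_real gtr0_norm// => h.
  have tu : t * rnorm u = r / 2 by rewrite /t; field; rewrite gt_eqF.
  have : t * rnorm (T u) < 1 by apply: h; rewrite tu; lra.
  have -> : 2 / r = t^-1 / rnorm u by rewrite /t; field; rewrite !gt_eqF.
  rewrite mulfVK ?gt_eqF// => h'.
  by rewrite -[t^-1]mulr1 mulrC -ler_pdivrMr ?invr_gt0// invrK mulrC ltW.
move=> u; apply/cvg_rnormP => e e0.
have C0 : 0 < `|C| + 1 by rewrite ltr_pwDr.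
have := near_rnorm u (divr_gt0 e0 C0); apply: filterS => v.
rewrite ltr_pdivlMr// -linear_opB// => /(le_lt_trans _); apply.
have := TC (u - v); have := rnorm_ge0 (u - v); have := ler_norm C; nra.
Qed.

Lemma id_sub_bounded T : bounded_operator T ->
  bounded_operator (fun u => u - T u).
Proof.
move=> /bounded_operatorP[Tl [C TC]]; apply/bounded_operatorP; split.
  by move=> z u v; rewrite Tl scalerBr opprD addrACA.
exists (1 + C) => u; have := rnormB u (T u); have := TC u; lra.
Qed.

Definition subspace (K : set H) : Prop :=
  K 0 /\ forall z u v, K u -> K v -> K (z *: u + v).

Definition rnorm_closed (K : set H) : Prop :=
  forall u, (forall e : R, 0 < e -> exists2 v, K v & rnorm (u - v) < e) -> K u.

(** Removing from [w] its component along [v] would lower the squared norm by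
    [(rnorm (inner w v) / rnorm v) ^+ 2]. *)
Lemma min_orthogonal (K : set H) w : subspace K ->
  (forall v, K v -> rnorm w <= rnorm (w - v)) -> forall v, K v -> inner w v = 0.
Proof.
move=> [K0 Kl] wmin v Kv; have [->|v0] := eqVneq v 0; first exact: inner0r.
have r0 : rnorm v != 0 by rewrite gt_eqF// rnorm_gt0.
have := wmin (((rnorm v ^- 2)%:C * inner w v) *: v).
rewrite -[X in K X]addr0 => /(_ (Kl _ _ _ Kv K0)).
rewrite -ler_sqr ?nnegrE ?rnorm_ge0// sqr_rnorm_proj// => h.
have : (rnorm (inner w v) / rnorm v) ^+ 2 = 0.
  by apply/eqP; rewrite eq_le sqr_ge0 andbT; lra.
by move/eqP; rewrite expf_eq0/= mulf_eq0 invr_eq0 (negbTE r0) orbF =>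
  /eqP/rnorm_eq0.
Qed.

(** For [v], [w] in a subspace the midpoint is no closer to [u] than the infimum, which makes
    minimising sequences Cauchy. *)
Lemma parallelogram u v w :
  rnorm (v - w) ^+ 2 = 2 * rnorm (u - v) ^+ 2 + 2 * rnorm (u - w) ^+ 2 -
    4 * rnorm (u - (2^-1 : R)%:C *: (v + w)) ^+ 2.
Proof.
have -> : v - w = (u - w) - (u - v).
  by rewrite opprB [RHS]addrC addrA addrNK.
have -> : u - (2^-1 : R)%:C *: (v + w) = (2^-1 : R)%:C *: ((u - w) + (u - v)).
  have h : u = (2^-1 : R)%:C *: (u + u).
    rewrite scalerDr -scalerDl -raddfD/= (_ : 2^-1 + 2^-1 = 1 :> R) ?scale1r//.
    by field.
  rewrite {1}h -scalerBr; congr (_ *: _).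
  by rewrite opprD addrACA addrC.
rewrite rnormZ rnorm_real ger0_norm// exprMn sqr_rnormB (sqr_rnormD (u - w)).
by field.
Qed.

Lemma orthogonal_projection (K : set H) u : subspace K -> rnorm_closed K ->
  exists2 p, K p & forall v, K v -> inner (u - p) v = 0.
Proof.
move=> Ks Kc; have [K0 Kl] := Ks.
pose E := [set rnorm (u - v) | v in K].
have Ei : has_inf E.
  split; first by exists (rnorm (u - 0)); exists 0.
  by exists 0 => _ [v _ <-]; exact: rnorm_ge0.
pose d := inf E.
have dle v : K v -> d <= rnorm (u - v).
  by move=> Kv; apply: ge_inf; [exact: Ei.2|exists v].
have d0 : 0 <= d.
  by apply: lb_le_inf; [exact: Ei.1|move=> _ [v _ <-]; exact: rnorm_ge0].
have [s sP] : {s : nat -> H &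
    forall n, K (s n) /\ rnorm (u - s n) < d + n.+1%:R^-1}.
  apply: (@choice _ _ (fun n v => K v /\ rnorm (u - v) < d + n.+1%:R^-1)) => n.
  have n0 : 0 < n.+1%:R^-1 :> R by rewrite invr_gt0.
  by have [_ [v Kv <-] h] := inf_adherent n0 Ei; exists v.
(* With [e = n.+1%:R^-1], the parallelogram law gives at most [4 (d + e)^2 - 4 d^2 = 8 d e + 4 e^2],
   and [e^2 <= e]. *)
have cauchy n m : (n <= m)%N ->
    rnorm (s n - s m) ^+ 2 <= 4 * (2 * d + 1) * n.+1%:R^-1.
  move=> nm; rewrite (parallelogram u).
  have [Kn hn] := sP n; have [Km hm] := sP m.
  have /dle : K ((2^-1 : R)%:C *: (s n + s m)).
    rewrite -[X in K X]addr0; apply: (Kl) => //.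
    by rewrite -[s n]scale1r; exact: Kl.
  move: (rnorm_ge0 (u - s n)) (rnorm_ge0 (u - s m)).
  have : m.+1%:R^-1 <= n.+1%:R^-1 :> R by rewrite lef_pV2 ?posrE// ler_nat.
  have : n.+1%:R^-1 <= 1 :> R by rewrite invf_le1// ler1n.
  have : 0 < n.+1%:R^-1 :> R by rewrite invr_gt0.
  move: hn hm; set c := rnorm (u - _ *: _).
  move: (rnorm (u - s n)) (rnorm (u - s m)) (n.+1%:R^-1) (m.+1%:R^-1).
  move=> a b e f ae bf e0 e1 fe a0 b0 dc.
  have : a ^+ 2 <= (d + e) ^+ 2 by rewrite ler_sqr ?nnegrE//; lra.
  have : b ^+ 2 <= (d + e) ^+ 2 by rewrite ler_sqr ?nnegrE//; lra.
  have : d ^+ 2 <= c ^+ 2 by rewrite ler_sqr ?nnegrE//; lra.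
  have : e ^+ 2 <= e by rewrite expr2 ler_piMr// ltW.
  have : (d + e) ^+ 2 = d ^+ 2 + 2 * (d * e) + e ^+ 2 by ring.
  lra.
have [p sp] : exists p : H, s n @[n --> \oo] --> p.
  apply: (@cauchy_rnorm_cvg R H nat \oo _ s) => e e0.
  have c0 : 0 < 4 * (2 * d + 1) by lra.
  have [n nP] := @ltr_add_invr R 0 _ (divr_gt0 (exprn_gt0 2 e0) c0).
  rewrite add0r in nP.
  exists (s n); exists n => // m /= nm.
  rewrite -ltr_sqr ?nnegrE ?rnorm_ge0 ?(ltW e0)//.
  by rewrite (le_lt_trans (cauchy _ _ nm))// mulrC -ltr_pdivlMr.
move/cvg_rnormP: sp => sp; exists p.
  apply: Kc => e e0; have [n _ nP] := sp e e0.
  by exists (s n); [exact: (sP n).1|exact: nP n (leqnn n)].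
apply: min_orthogonal => // v Kv; rewrite -addrA -opprD.
have Kpv : K (1 *: v + p).
  apply: (Kl) => //; apply: Kc => e e0; have [n _ nP] := sp e e0.
  by exists (s n); [exact: (sP n).1|exact: nP n (leqnn n)].
(* What remains is that the limit [p] attains the infimum [d]. *)
rewrite scale1r addrC in Kpv; apply: le_trans (dle _ Kpv).
apply/ler_addgt0Pr => e e0; have e20 : 0 < e / 2 by rewrite divr_gt0.
have [n _ nP] := sp _ e20; have [m mP] := @ltr_add_invr R 0 _ e20.
rewrite add0r in mP; pose l := maxn n m.
have := nP l (leq_maxl _ _); have [_] := sP l.
have : l.+1%:R^-1 <= m.+1%:R^-1 :> R.
  by rewrite lef_pV2 ?posrE// ler_nat ltnS leq_maxr.
have := rnormD (u - s l) (s l - p); rewrite addrA addrNK [rnorm (s l - p)]rnormBC.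
move: mP => /=; move: (l.+1%:R^-1) (m.+1%:R^-1) => *; lra.
Qed.

(** The bound makes the kernel of [h] closed, so some [e] outside it is orthogonal to it. As
    [h e *: u - h u *: e] is in the kernel, pairing with [e] recovers [h u]. *)
Lemma riesz (h : H -> R[i]) (C : R) :
  (forall z u v, h (z *: u + v) = z * h u + h v) ->
  (forall u, rnorm (h u) <= C * rnorm u) ->
  exists w, forall u, h u = inner u w.
Proof.
move=> hl hC.
have h0 : h 0 = 0.
  by have := hl (-1) 0 0; rewrite scaler0 addr0 mulN1r addNr.
have [allz|] := pselect (forall u, h u = 0).
  by exists 0 => u; rewrite inner0r allz.
move=> /existsNP[u0 /eqP hu0].
pose K := [set u | h u = 0].
have Ks : subspace K.
  by split=> // z u v /= hu hv; rewrite /K/= hl hu hv mulr0 addr0.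
have hB u v : h (u - v) = h u - h v.
  by rewrite addrC -scaleN1r hl mulN1r addrC.
have Kc : rnorm_closed K.
  move=> u uK; apply: rnorm_small => e e0.
  have C0 : 0 < `|C| + 1 by rewrite ltr_pwDr.
  have [v Kv] := uK _ (divr_gt0 e0 C0).
  rewrite ltr_pdivlMr// => uv; apply: ltW; apply: le_lt_trans uv.
  have := hC (u - v); rewrite hB Kv subr0.
  by have := rnorm_ge0 (u - v); have := ler_norm C; nra.
have [p Kp pK] := orthogonal_projection u0 Ks Kc.
pose e := u0 - p.
have he : h e = h u0 by rewrite hB Kp subr0.
have ee : inner e e != 0.
  apply: contraNN hu0 => /eqP ee; rewrite -he.
  move/(congr1 (@Re R)): ee; rewrite inner_rnorm/= => /eqP.
  by rewrite sqrf_eq0 => /eqP/rnorm_eq0 ->; rewrite h0.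
exists (conjc (h e / inner e e) *: e) => u.
have Ku : K (h e *: u - h u *: e).
  by rewrite /K/= -scaleNr hl -[(- _) *: _]addr0 hl h0 addr0; ring.
have := pK _ Ku; rewrite -/e inner_conj innerBl !innerZl => /eqP.
rewrite conjc_eq0 subr_eq0 => /eqP hE.
by rewrite innerZr conjcK mulrAC hE mulfK.
Qed.

(** Riesz represents [u |-> inner (T u) v]; testing at [u = S v] bounds [S]. *)
Lemma adjoint_exists T : bounded_operator T ->
  exists2 S, bounded_operator S & adjoint_pair T S.
Proof.
move=> /bounded_operatorP[Tl [C TC]].
have C0 : 0 <= `|C| by [].
have TC' u : rnorm (T u) <= `|C| * rnorm u.
  by rewrite (le_trans (TC u))// ler_wpM2r ?rnorm_ge0// ler_norm.
have [S SP] : {S & forall v u, inner (T u) v = inner u (S v)}.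
  apply: (@choice _ _ (fun v w => forall u, inner (T u) v = inner u w)) => v.
  apply: (@riesz _ (`|C| * rnorm v)) => [z u w|u].
    by rewrite Tl innerDl innerZl.
  rewrite (le_trans (cauchy_schwarz _ _))//.
  by rewrite mulrAC ler_wpM2r ?rnorm_ge0.
exists S; last by move=> u v; rewrite SP.
apply/bounded_operatorP; split.
  move=> z u v; apply: inner_inj => w.
  by rewrite -SP !innerDr !innerZr -!SP.
exists `|C| => v; have [->|/eqP Sv] := pselect (S v = 0).
  by rewrite rnorm0 mulr_ge0 ?rnorm_ge0.
have Sv0 : 0 < rnorm (S v) by exact: rnorm_gt0.
rewrite -(ler_pM2l Sv0) -expr2.
have <- : rnorm (inner (T (S v)) v) = rnorm (S v) ^+ 2.
  by rewrite SP inner_rnorm rnorm_real ger0_norm ?sqr_ge0.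
rewrite (le_trans (cauchy_schwarz _ _))// mulrA ler_wpM2r ?rnorm_ge0//.
by rewrite mulrC TC'.
Qed.

End BoundedOperators.

(** * Support projections *)

Section SupportProjection.
Variables (R : realType) (A : cstarType R) (U : universal_rep A).
Implicit Types (a b : A) (u v : U) (S T p q : U -> U) (phi : A -> R[i]).

Lemma urep_contractive a u : rnorm (urep U a u) <= rnorm a * rnorm u.
Proof.
exact: (star_rep_contractive (@urep_linear _ _ U) (@urepM _ _ U)
  (@urep_adj _ _ U)).
Qed.

Lemma urep_nondegenerate u : (forall a, urep U a u = 0) -> u = 0.
Proof.
move=> u0; apply: (@uvec_total _ _ U) => phi a _.
by rewrite urep_adj u0 inner0r.
Qed.

(** The family of all [urep U a] is self-adjoint: the relation for [cadj a] turns into the one for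
    [a] under adjoints. *)
Lemma commutant_adjoint S S' : commutant (range (urep U)) S ->
  bounded_operator S' -> adjoint_pair S S' -> commutant (range (urep U)) S'.
Proof.
move=> [Sb Sc] S'b SS'; split=> // _ [a _ <-]; apply/funext => v /=.
apply: inner_inj => u.
have := Sc _ (ex_intro2 _ _ (cadj a) I erefl) => /(congr1 (fun T => T u)) /= aS.
have adj' w t : inner w (urep U a t) = inner (urep U (cadj a) w) t.
  by rewrite urep_adj cadjK.
by rewrite -SS' adj' -aS SS' adj'.
Qed.

Lemma enveloping_id_sub T : enveloping T -> enveloping (fun u => u - T u).
Proof.
move=> [Tb Tc]; split; first exact: id_sub_bounded.
move=> S XS; have /(congr1 (fun F => F _)) TS := Tc S XS.
have [Sl _] := XS.1.
by apply/funext => u /=; rewrite linear_opB// -[T (S u)]/((T \o S) u) Tc.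
Qed.

Section Projections.
Variable p : U -> U.
Hypothesis pP : projection p.

Lemma inner_projection u : inner (p u) u = (rnorm (p u) ^+ 2)%:C.
Proof.
have [_ padj pp] := pP.
by rewrite -[in LHS]pp /= padj inner_rnorm.
Qed.

Lemma rnorm_projection u : rnorm (p u) <= rnorm u.
Proof.
have [pu0|pu0] := leP (rnorm (p u)) 0; first exact: le_trans pu0 (rnorm_ge0 _).
rewrite -(ler_pM2l pu0) -expr2.
have <- : rnorm (inner (p u) u) = rnorm (p u) ^+ 2.
  by rewrite inner_projection rnorm_real ger0_norm ?sqr_ge0.
exact: cauchy_schwarz.
Qed.

Lemma projection_fix u : rnorm (p u) = rnorm u -> p u = u.
Proof.
move=> pu; apply: subr0_eq; apply: rnorm_eq0; apply/eqP.
rewrite -(sqrf_eq0) sqr_rnormB.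
have [_ padj pp] := pP.
by rewrite inner_projection/= pu; apply/eqP; ring.
Qed.

(** The value is [rnorm (p xi) ^+ 2], so it is 1 only if the contraction [p] preserves the norm of
    [xi], and then [p] fixes [xi]. *)
Lemma normal_ext_projection phi : rnorm (uvec U phi) = 1 ->
  normal_ext U phi p = 1 <-> p (uvec U phi) = uvec U phi.
Proof.
move=> xi1; rewrite /normal_ext inner_projection; split=> [h|->].
  apply: projection_fix; rewrite xi1; apply/eqP.
  move/complexI: h => /eqP; rewrite sqrf_eq1 => /orP[//|/eqP h].
  by have := rnorm_ge0 (p (uvec U phi)); rewrite h oppr_ge0 ler10.
by rewrite xi1 expr1n.
Qed.

End Projections.

(* The support is the projection onto the common kernel K of all operators of
   the enveloping algebra that annihilate the vector xi of the state. Since K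
   is invariant under the commutant, which is stable under adjoints, this
   projection commutes with the commutant. *)
Lemma support_exists phi : rnorm (uvec U phi) = 1 ->
  exists2 p, is_proj_inf [set q | projection q /\ normal_ext U phi q = 1] p &
    normal_ext U phi p = 1.
Proof.
set xi := uvec U phi => xi1.
pose K := [set v | forall T, enveloping T -> T xi = 0 -> T v = 0].
have Ks : subspace K.
  split=> [T [[Tl _] _] _|z u v Ku Kv T eT Txi]; first exact: linear_op0.
  by have [[Tl _] _] := eT; rewrite Tl Ku// Kv// scaler0 addr0.
have Kc : rnorm_closed K.
  move=> u uK T eT Txi; apply: rnorm_small => e e0.
  have [/bounded_operatorP[Tl [C TC]] _] := eT.
  have C0 : 0 < `|C| + 1 by rewrite ltr_pwDr.
  have [v Kv] := uK _ (divr_gt0 e0 C0).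
  rewrite ltr_pdivlMr// => uv; apply: ltW; apply: le_lt_trans uv.
  have := TC (u - v); rewrite linear_opB// (Kv _ eT Txi) subr0.
  by have := rnorm_ge0 (u - v); have := ler_norm C; nra.
have [P PP] : {P : U -> U & forall u, K (P u) /\
    forall v, K v -> inner (u - P u) v = 0}.
  apply: (@choice _ _ (fun u w => K w /\ forall v, K v -> inner (u - w) v = 0)).
  by move=> u; have [w Kw wK] := orthogonal_projection u Ks Kc; exists w.
have KB u v : K u -> K v -> K (u - v).
  by move=> Ku Kv; rewrite addrC -scaleN1r; exact: Ks.2.
(* Linearity, the fixing of [K] and commutation with the commutant are all read off from this
   characterisation of [P u]. *)
have Puniq u w : K w -> (forall v, K v -> inner (u - w) v = 0) -> P u = w.
  move=> Kw wK; apply: subr0_eq; apply: rnorm_eq0; apply/eqP.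
  have [KPu PuK] := PP u; have Kd := KB _ _ KPu Kw.
  have : inner (P u - w) (P u - w) = 0.
    have e : P u - w = (u - w) - (u - P u) by rewrite opprB [RHS]addrC addrA addrNK.
    by rewrite {1}e innerBl wK// PuK// subr0.
  by rewrite inner_rnorm => /(congr1 (@Re R))/= /eqP; rewrite sqrf_eq0.
have Pl : linear P.
  move=> z u v; apply: Puniq; first by apply: Ks.2; exact: (PP _).1.
  move=> w Kw; have -> : z *: u + v - (z *: P u + P v) =
      z *: (u - P u) + (v - P v) by rewrite scalerBr opprD addrACA.
  by rewrite innerDl innerZl (PP u).2// (PP v).2// mulr0 addr0.
have PadjK u v : inner (P u) v = inner (P u) (P v).
  apply: subr0_eq; rewrite -innerBr inner_conj.
  by rewrite (PP v).2 ?conjc0//; exact: (PP u).1.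
have Padj : adjoint_pair P P.
  by move=> u v; rewrite PadjK inner_conj -PadjK -inner_conj.
have PK v : K v -> P v = v.
  by move=> Kv; apply: Puniq => // w _; rewrite subrr inner0l.
have Pxi : P xi = xi by apply: PK => T.
have Pb : bounded_operator P.
  apply/bounded_operatorP; split=> //; exists 1 => u; rewrite mul1r.
  have [pu0|pu0] := leP (rnorm (P u)) 0; first exact: le_trans pu0 (rnorm_ge0 _).
  rewrite -(ler_pM2l pu0) -expr2.
  have <- : rnorm (inner (P u) u) = rnorm (P u) ^+ 2.
    by rewrite PadjK inner_rnorm rnorm_real ger0_norm ?sqr_ge0.
  exact: cauchy_schwarz.
have XK S v : commutant (range (urep U)) S -> K v -> K (S v).
  move=> XS Kv T eT Txi; rewrite -[T (S v)]/((T \o S) v) eT.2//= Kv//.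
  by have [[Sl _] _] := XS; exact: linear_op0.
have Pproj : projection P.
  split=> //; last by apply/funext => u /=; apply: PK; exact: (PP u).1.
  split=> // S XS; apply/funext => u /=.
  have [S' S'b SS'] := adjoint_exists XS.1.
  apply: Puniq; first by apply: XK => //; exact: (PP u).1.
  move=> v Kv; have [[Sl _] _] := XS.
  rewrite -linear_opB// SS' (PP u).2//; apply: XK => //.
  exact: commutant_adjoint SS'.
have P1 : normal_ext U phi P = 1 by apply/normal_ext_projection.
(* The infimum is attained: [P] carries the state, so every lower bound lies below it. *)
exists P => //; split=> // [q [qP q1] u|s _ sle]; last exact: sle.
have qxi : q xi = xi by apply/normal_ext_projection.
(* As [1 - q] is in the enveloping algebra and kills [xi], it kills [K] by definition. *)
have qK v : K v -> q v = v.
  move=> Kv; apply/esym/subr0_eq.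
  apply: (Kv (fun u => u - q u)); first by have [/enveloping_id_sub] := qP.
  by rewrite qxi subrr.
rewrite !inner_projection// lecR ler_sqr ?nnegrE ?rnorm_ge0//.
have [pu0|pu0] := leP (rnorm (P u)) 0; first exact: le_trans pu0 (rnorm_ge0 _).
rewrite -(ler_pM2l pu0) -expr2.
have <- : rnorm (inner (P u) (q u)) = rnorm (P u) ^+ 2.
  have [_ qadj _] := qP.
  by rewrite -qadj qK ?inner_projection ?rnorm_real ?ger0_norm ?sqr_ge0//;
    exact: (PP u).1.
exact: cauchy_schwarz.
Qed.

(** An infimum need not a priori carry the state. The constructed [P] does and lies below the chosen
    [supp U phi], hence below [s], which forces the value 1. *)
Lemma supp_le phi s : rnorm (uvec U phi) = 1 -> projection s ->
  operator_le (supp U phi) s <-> normal_ext U phi s = 1.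
Proof.
move=> xi1 sP; have [P Pinf P1] := support_exists xi1.
have [suppP supp_lb supp_glb] :
    is_proj_inf [set q | projection q /\ normal_ext U phi q = 1] (supp U phi).
  exact: (xgetPex (fun=> 0) (ex_intro _ P Pinf)).
split=> [ples|s1]; last exact: supp_lb.
apply/eqP; rewrite eq_le; apply/andP; split.
  rewrite /normal_ext inner_projection// -[1]/(1%:C) lecR.
  rewrite expr_le1 ?rnorm_ge0// -xi1; exact: rnorm_projection.
rewrite -P1; apply: le_trans (ples _).
by apply: supp_glb; [case: Pinf|case: Pinf => _ + _; exact].
Qed.

(** The closure sees the support only through the closed projections above it, so both choices by
    [xget] are made from the same set. *)
Lemma closed_supp_eq phi psi :
  rnorm (uvec U phi) = 1 -> rnorm (uvec U psi) = 1 ->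
  (forall s, closed_projection s ->
    normal_ext U phi s = 1 <-> normal_ext U psi s = 1) ->
  closed_supp U phi = closed_supp U psi.
Proof.
move=> xi1 xi1' h; rewrite /closed_supp /proj_closure; congr xget.
have e s : closed_projection s ->
    operator_le (supp U phi) s <-> operator_le (supp U psi) s.
  move=> sc; have sP := sc.1.
  by split=> /supp_le h1; apply/supp_le => //; apply/h => //; exact: h1.
apply/seteqP; split=> q [qc ql qm]; split=> //; first exact/e.
- by move=> s sc /(e _ sc); exact: qm.
- exact/e.
- by move=> s sc /(e _ sc); exact: qm.
Qed.

End SupportProjection.

(** * States and their cyclic vectors *)

Section States.
Variables (R : realType) (A : cstarType R) (U : universal_rep A).
Implicit Types (a b c : A) (u v : U) (phi psi : A -> R[i]).

Lemma stateB phi a b : state phi -> phi (a - b) = phi a - phi b.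
Proof.
by case=> philin _ _; rewrite addrC -scaleN1r philin mulN1r addrC.
Qed.

Lemma stateZ phi z a : state phi -> phi (z *: a) = z * phi a.
Proof.
move=> phist; have [philin _ _] := phist.
have phi0 : phi 0 = 0 by rewrite -(subrr 0) stateB// subrr.
by rewrite -[z *: a]addr0 philin phi0 addr0.
Qed.

Lemma state_le phi a : state phi -> rnorm (phi a) <= rnorm a.
Proof.
move=> phist; have [_ _ phi1] := phist.
have le1 b : rnorm b <= 1 -> rnorm (phi b) <= 1.
  move=> b1; rewrite -lee_fin -phi1; apply: ereal_sup_ubound.
  by exists b.
have [->|a0] := eqVneq a 0.
  by rewrite -(subrr 0) stateB// !subrr !rnorm0.
have a_gt0 : 0 < rnorm a by exact: rnorm_gt0.
have := le1 ((rnorm a)^-1%:C *: a).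
rewrite stateZ// rnormZ rnormM rnorm_real gtr0_norm ?invr_gt0//.
rewrite mulVf ?gt_eqF// => /(_ (lexx _)).
by rewrite mulrC ler_pdivrMr// mul1r.
Qed.

Lemma state_norm_adherent phi (e : R) : state phi -> 0 < e ->
  exists2 a, rnorm a <= 1 & 1 - e < rnorm (phi a).
Proof.
move=> [_ _ phi1] e0.
have : ((1 - e)%:E < ereal_sup [set (rnorm (phi a))%:E | a in [set a | rnorm a <= 1]%R])%E.
  by rewrite phi1 lte_fin; lra.
by move=> /ereal_sup_gt[_ [a /= a1 <-]]; rewrite lte_fin; exists a.
Qed.

Lemma gns_inner phi a b : state phi ->
  inner (urep U a (uvec U phi)) (urep U b (uvec U phi)) = phi (cmul (cadj b) a).
Proof.
by move=> phist; rewrite (uvec_gns U phist) urepM /= [RHS]urep_adj cadjK.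
Qed.

Lemma gns_sqr phi a : state phi ->
  rnorm (urep U a (uvec U phi)) ^+ 2 = Re (phi (cmul (cadj a) a)).
Proof. by move=> phist; rewrite -gns_inner// inner_rnorm. Qed.

Lemma gns_le phi a : state phi -> rnorm (urep U a (uvec U phi)) <= rnorm a.
Proof.
move=> phist; rewrite -ler_sqr ?nnegrE ?rnorm_ge0// gns_sqr// -rnorm_cstar.
exact: le_trans (Re_le_rnorm _) (state_le _ phist).
Qed.

Lemma positive_ge0 a u : positive a -> 0 <= inner (urep U a u) u.
Proof. by case=> c ->; rewrite urepM /= urep_adj cadjK inner_ge0. Qed.

(* For a = c^* c with |a| <= 1 this is <pi(a)^2 u, u> <= <pi(a) u, u>. *)
Lemma positive_contraction_sqr a u : positive a -> rnorm a <= 1 ->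
  rnorm (urep U a u) ^+ 2 <= Re (inner (urep U a u) u).
Proof.
case=> c ->; rewrite rnorm_cstar => c1.
have {}c1 : rnorm c <= 1 by rewrite -(expr_le1 (n := 2)) ?rnorm_ge0.
rewrite urepM/= urep_adj cadjK inner_rnorm/=.
have := urep_contractive (cadj c) (urep U c u).
rewrite rnorm_cadj => h; rewrite ler_sqr ?nnegrE ?rnorm_ge0//.
by rewrite (le_trans h)// ler_piMl ?rnorm_ge0.
Qed.

Section ApproximateIdentity.
Variables (D : directed) (I : D -> A).
Hypothesis IP : approximate_identity I.

Lemma approx_near_l a (e : R) : 0 < e ->
  \forall n \near tails D, rnorm (a - cmul (I n) a) < e.
Proof. by move=> e0; have [_ /(_ a)/cvg_rnormP/(_ e e0)] := IP. Qed.

Lemma approx_near_r a (e : R) : 0 < e ->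
  \forall n \near tails D, rnorm (a - cmul a (I n)) < e.
Proof. by move=> e0; have [_ _ /(_ a)/cvg_rnormP/(_ e e0)] := IP. Qed.

(** For [rnorm a <= 1], [|phi (a I_n)| <= |I_n xi|], and [|I_n xi|^2 <= Re (phi (I_n))]. Two losses
    of [e / 4] leave [|I_n xi|] above [1 - e / 2], whose square exceeds [1 - e]. *)
Lemma state_approx phi (e : R) : state phi -> 0 < e ->
  \forall n \near tails D, 1 - e < Re (phi (I n)).
Proof.
move=> phist e0; have [I1 _ _] := IP.
have e40 : 0 < e / 4 by rewrite divr_gt0.
have [a a1 phia] := state_norm_adherent phist e40.
apply: filterS (approx_near_r a e40) => n an.
have [Ipos In1] := I1 n.
have h1 : rnorm (phi (cmul a (I n))) <= rnorm (urep U (I n) (uvec U phi)).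
  rewrite -[a]cadjK -gns_inner//.
  have := cauchy_schwarz (urep U (I n) (uvec U phi)) (urep U (cadj a) (uvec U phi)).
  move=> /le_trans; apply; rewrite ler_piMr ?rnorm_ge0//.
  by rewrite (le_trans (gns_le _ phist))// rnorm_cadj.
have h2 : rnorm (phi a) <= rnorm (phi (cmul a (I n))) + e / 4.
  rewrite -[phi a](addrNK (phi (cmul a (I n)))) addrC.
  rewrite (le_trans (rnormD _ _))// lerD2l -stateB//.
  by rewrite (le_trans (state_le _ phist))// ltW.
have h3 := positive_contraction_sqr (uvec U phi) Ipos In1.
rewrite (uvec_gns U phist).
have := rnorm_ge0 (urep U (I n) (uvec U phi)).
move: h1 h2 h3 phia; move: (rnorm (urep _ _ _)) => r; nra.
Qed.

(** Totality only tests vectors against the [urep U a (uvec U psi)], so a limit [eta] is produced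
    first and then identified by such tests. *)
Lemma state_vector_cvg phi : state phi ->
  urep U (I n) (uvec U phi) @[n --> tails D] --> uvec U phi.
Proof.
move=> phist; have [I1 _ _] := IP.
have [eta etaP] : exists eta : U,
    urep U (I n) (uvec U phi) @[n --> tails D] --> eta.
  apply: (@cauchy_rnorm_cvg R U D (tails D) _ (fun n => urep U (I n) (uvec U phi))) => e e0.
  (* The squared distance of [I_m xi] and [I_n xi] is at most [2 - 2 Re (phi (I_m I_n))]. Here
     [phi (I_m I_n)] is within [e^2 / 8] of [phi (I_m)], whose real part exceeds [1 - e^2 / 8]; the
     total is below [e^2 / 2]. *)
  have d0 : 0 < e ^+ 2 / 8 by rewrite divr_gt0// exprn_gt0.
  have [m mP] := filter_ex (state_approx phist d0).
  exists (urep U (I m) (uvec U phi)).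
  apply: filterS (approx_near_r (I m) d0) => n.
  move=> /(le_lt_trans (state_le _ phist)); rewrite stateB// => mn.
  rewrite -ltr_sqr ?nnegrE ?rnorm_ge0 ?(ltW e0)// rnormBC sqr_rnormB gns_inner//.
  have -> : cadj (I m) = I m by exact: positive_selfadjoint (I1 m).1.
  have := le_lt_trans (Re_le_rnorm _) mn; rewrite raddfB/=.
  have h l : rnorm (urep U (I l) (uvec U phi)) ^+ 2 <= 1.
    by rewrite expr_le1 ?rnorm_ge0// (le_trans (gns_le _ phist))// (I1 l).2.
  have := h n; have := h m; lra.
suff e : uvec U phi = eta by move: etaP; rewrite -e.
apply: subr0_eq; apply: (@uvec_total _ _ U) => psi a psist.
apply: rnorm_small => e e0.
have e20 : 0 < e / 2 by rewrite divr_gt0.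
have C0 : 0 < rnorm (urep U a (uvec U psi)) + 1 by rewrite ltr_pwDr ?rnorm_ge0.
move/cvg_rnormP: etaP => /(_ _ (divr_gt0 e20 C0)) etaP.
have D0 : 0 < rnorm (uvec U phi) + 1 by rewrite ltr_pwDr ?rnorm_ge0.
have [n [/= n1 n2]] := filter_ex (filterI etaP (approx_near_l a (divr_gt0 e20 D0))).
set xa := urep U a (uvec U psi) in C0 n1 *; set xi := uvec U phi in n1 D0 n2 *.
(* Being self-adjoint, [I n] may act on either side; both terms become small. *)
have -> : inner xa (xi - eta) = inner (urep U (a - cmul (I n) a) (uvec U psi)) xi -
    inner xa (eta - urep U (I n) xi).
  have Ins : cadj (I n) = I n by exact: positive_selfadjoint (I1 n).1.
  rewrite (star_repB (@urep_linear _ _ U)) urepM /= -/xa innerBl !innerBr.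
  have -> : inner (urep U (I n) xa) xi = inner xa (urep U (I n) xi).
    by rewrite urep_adj Ins.
  by rewrite opprB addrA addrNK.
rewrite (le_trans (rnormB _ _))//.
have := cauchy_schwarz (urep U (a - cmul (I n) a) (uvec U psi)) xi.
have := cauchy_schwarz xa (eta - urep U (I n) xi).
have := gns_le (a - cmul (I n) a) psist.
move: n1 n2; rewrite !ltr_pdivlMr//.
have := rnorm_ge0 xa; have := rnorm_ge0 xi.
have := rnorm_ge0 (eta - urep U (I n) xi).
have := rnorm_ge0 (a - cmul (I n) a).
set p := rnorm (inner _ _); set q := rnorm (inner _ _).
set r := rnorm (urep U (a - _) _).
set s := rnorm xa; set t := rnorm xi; set x := rnorm (eta - _).
set y := rnorm (a - _) => y0 x0 t0 s0 h1 h2 ry qle ple.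
have : r * t <= y * t by rewrite ler_wpM2r.
nra.
Qed.

(** At most 1, because the [I_n xi] have norm at most 1 and tend to [xi]; at least 1, because
    [Re (phi (I_n))] exceeds [1 - e] eventually and is bounded by [rnorm xi]. *)
Lemma state_vector_norm phi : state phi -> rnorm (uvec U phi) = 1.
Proof.
move=> phist; have [I1 _ _] := IP; have /cvg_rnormP xiP := state_vector_cvg phist.
apply/eqP; rewrite eq_le; apply/andP; split; apply/ler_addgt0Pr => e e0.
  have [n nP] := filter_ex (xiP e e0).
  have := rnormD (uvec U phi - urep U (I n) (uvec U phi)) (urep U (I n) (uvec U phi)).
  rewrite addrNK; have := gns_le (I n) phist; have := (I1 n).2; rewrite /= in nP; lra.
have [n nP] := filter_ex (state_approx phist e0).
have := Re_le_rnorm (inner (urep U (I n) (uvec U phi)) (uvec U phi)).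
have := cauchy_schwarz (urep U (I n) (uvec U phi)) (uvec U phi).
have := gns_le (I n) phist; have := (I1 n).2; have := rnorm_ge0 (uvec U phi).
move: nP; rewrite (uvec_gns U phist) /=; nra.
Qed.

End ApproximateIdentity.

End States.

(** * The action of an iterated function system on states *)

Section ConvexCombination.
Variables (R : realType) (k : nat) (w : 'I_k -> R) (x : 'I_k -> R[i]).

Lemma Re_comb : Re (\sum_(i < k) (w i)%:C * x i) = \sum_(i < k) w i * Re (x i).
Proof. by rewrite raddf_sum; apply: eq_bigr => i _; exact: Re_realM. Qed.

Lemma rnorm_comb : (forall i, 0 <= w i) ->
  rnorm (\sum_(i < k) (w i)%:C * x i) <= \sum_(i < k) w i * rnorm (x i).
Proof.
move=> w0; rewrite -lecR -norm_rnorm raddf_sum (le_trans (ler_norm_sum _ _ _))//.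
apply: ler_sum => i _ /=.
by rewrite norm_rnorm rnormM rnorm_real ger0_norm.
Qed.

End ConvexCombination.

Section StarHomomorphism.
Variables (R : realType) (A : cstarType R) (U : universal_rep A).
Variable f : A -> U -> U.
Hypothesis fhom : star_hom f.
Implicit Types (a b : A) (u v : U) (phi psi : A -> R[i]).

Lemma star_hom_contractive a u : rnorm (f a u) <= rnorm a * rnorm u.
Proof. by have [_ fl fM fadj] := fhom; exact: star_rep_contractive. Qed.

Lemma star_hom_op_linear a : linear (f a).
Proof. by have [/(_ a)[[[fl _] _] _] _ _ _] := fhom. Qed.

Lemma normal_ext_star_hom_le phi a : rnorm (uvec U phi) = 1 ->
  rnorm (normal_ext U phi (f a)) <= rnorm a.
Proof.
move=> xi1; rewrite (le_trans (cauchy_schwarz _ _))// xi1 mulr1.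
by rewrite (le_trans (star_hom_contractive _ _))// xi1 mulr1.
Qed.

Lemma normal_ext_star_hom_sqr phi a :
  normal_ext U phi (f (cmul (cadj a) a)) =
  (rnorm (f a (uvec U phi)) ^+ 2)%:C.
Proof. by have [_ fl fM fadj] := fhom; exact: star_rep_sqr. Qed.

(* [I] is an approximate identity along which [f] is relatively proper, [J] an
   arbitrary one: f (J l) f (I n) pi (J m) xi is compared with xi. *)
Lemma star_hom_vector_cvg (D : directed) (J : D -> A) phi :
  relatively_proper f -> approximate_identity J -> state phi ->
  f (J l) (uvec U phi) @[l --> tails D] --> uvec U phi.
Proof.
move=> [D' [I [IP _ Istrict]]] JP phist; set xi := uvec U phi.
have xi1 : rnorm xi = 1 by exact: (state_vector_norm U JP phist).
apply/cvg_rnormP => e e0.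
(* The chain [xi], [eta], [f a eta], [f b (f a eta)], [f b eta], [f b xi] has five links. *)
have d0 : 0 < e / 5 by rewrite divr_gt0.
set d := e / 5 in d0.
have /cvg_rnormP/(_ d d0) := state_vector_cvg (U := U) JP phist => /filter_ex[m /=].
set eta := urep U (J m) xi => etaP.
have eta1 : rnorm eta <= 1.
  by rewrite (le_trans (gns_le _ _ phist))//; have [/(_ m)[]] := JP.
have d0' : (0 < d%:E)%E by rewrite lte_fin.
have /filter_ex[n /= Nd] : \forall n \near tails D',
    (operator_norm (fun u => f (I n) (urep U (J m) u) - urep U (J m) u)%R < d%:E)%E.
  by have [/(_ _ (open_ereal_lt' d0'))] := Istrict (J m).
have fxi : rnorm (f (I n) eta - eta) < d.
  rewrite -lte_fin; apply: le_lt_trans Nd.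
  by apply: ereal_sup_ubound; exists xi; rewrite //= xi1.
apply: filterS (approx_near_l JP (I n) d0) => l aP.
set a := I n in aP fxi; set b := J l in aP *.
have b1 : rnorm b <= 1 by have [/(_ l)[]] := JP.
have fbl : linear (f b) by exact: star_hom_op_linear.
have pb : rnorm (f a eta - f b (f a eta)) < d.
  have [_ fl fM _] := fhom.
  rewrite -[f b (f a eta)]/((f b \o f a) eta) -fM -(star_repB fl).
  apply: le_lt_trans aP; rewrite (le_trans (star_hom_contractive _ _))//.
  by rewrite ler_piMr ?rnorm_ge0.
have fbB u v : rnorm (f b u - f b v) <= rnorm (u - v).
  rewrite -linear_opB// (le_trans (star_hom_contractive _ _))//.
  by rewrite ler_piMl ?rnorm_ge0.
have := rnorm_triangle xi eta (f b xi).
have := rnorm_triangle eta (f a eta) (f b xi).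
have := rnorm_triangle (f a eta) (f b (f a eta)) (f b xi).
have := rnorm_triangle (f b (f a eta)) (f b eta) (f b xi).
have := fbB (f a eta) eta; have := fbB eta xi.
rewrite [rnorm (eta - xi)]rnormBC [rnorm (eta - f a eta)]rnormBC.
by rewrite /d in d0 etaP fxi pb *; lra.
Qed.

End StarHomomorphism.

Section DualIFS.
Variables (R : realType) (A : cstarType R) (U : universal_rep A).
Variables (k : nat) (f : 'I_k -> A -> U -> U) (w : 'I_k -> R).
Hypotheses (fP : dual_ifs f) (wP : open_simplex w).
Variables (D : directed) (J : D -> A).
Hypothesis JP : approximate_identity J.
Implicit Types (a b : A) (phi psi : A -> R[i]).

Lemma simplex_ge0 i : 0 <= w i.
Proof. by have [/(_ i)/andP[/ltW]] := wP. Qed.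

Lemma ifs_action_sqr phi a :
  ifs_action w f phi (cmul (cadj a) a) =
  (\sum_(i < k) w i * rnorm (f i a (uvec U phi)) ^+ 2)%:C.
Proof.
rewrite raddf_sum; apply: eq_bigr => i _.
by rewrite (normal_ext_star_hom_sqr (fP i).1) -rmorphM.
Qed.

(** The delicate point is norm one: a single [l] must bring [f i (J l) xi] close to [xi] for all
    [i], and finiteness of the index set provides it. *)
Lemma ifs_action_state phi : state phi -> state (ifs_action w f phi).
Proof.
move=> phist; have xi1 := state_vector_norm U JP phist; split.
- move=> z a b; rewrite /ifs_action mulr_sumr -big_split/=.
  apply: eq_bigr => i _; have [[_ fl _ _] _] := fP i.
  by rewrite /normal_ext fl innerDl innerZl mulrDr mulrCA.
- move=> _ [c ->]; rewrite ifs_action_sqr ler0c sumr_ge0// => i _.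
  by rewrite mulr_ge0 ?sqr_ge0 ?simplex_ge0.
- apply/eqP; rewrite eq_le; apply/andP; split.
    apply: ge_ereal_sup => _ [a /= a1 <-]; rewrite lee_fin.
    rewrite (le_trans (rnorm_comb _ simplex_ge0))//.
    have [_ <-] := wP; apply: ler_sum => i _.
    rewrite ler_piMr ?simplex_ge0//.
    by rewrite (le_trans (normal_ext_star_hom_le (fP i).1 _ xi1)).
  apply/lee_addgt0Pr => e e0.
  have near i : \forall l \near tails D,
      rnorm (uvec U phi - f i (J l) (uvec U phi)) < e.
    have [fhom fprop] := fP i.
    by have /cvg_rnormP/(_ e e0) := star_hom_vector_cvg fhom fprop JP phist.
  have [l lP] := filter_ex (filter_forall _ near).
  have Tl : 1 - e <= rnorm (ifs_action w f phi (J l)).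
    apply: le_trans (Re_le_rnorm _); rewrite Re_comb.
    have [_ w1] := wP; rewrite -[1 - e]mul1r -w1 mulr_suml.
    apply: ler_sum => i _; rewrite ler_wpM2l ?simplex_ge0//.
    have := cauchy_schwarz (uvec U phi - f i (J l) (uvec U phi)) (uvec U phi).
    have := Re_le_rnorm (inner (uvec U phi - f i (J l) (uvec U phi)) (uvec U phi)).
    rewrite innerBl raddfB/= inner_rnorm xi1 expr1n mulr1 /normal_ext/=.
    by have := lP i; rewrite /=; lra.
  rewrite -leeBlDr// -EFinB (le_trans (y := (rnorm (ifs_action w f phi (J l)))%:E))//.
  apply: ereal_sup_ubound; exists (J l) => //=.
  by have [/(_ l)[]] := JP.
Qed.

Lemma iter_ifs_action_state phi n :
  state phi -> state (iter n (ifs_action w f) phi).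
Proof. by move=> phist; elim: n => // n IH; exact: ifs_action_state. Qed.

End DualIFS.

Section Contraction.
Variables (R : realType) (A : cstarType R) (U : universal_rep A).
Variable L : A -> \bar R.
Hypothesis Lseminorm : extended_seminorm L.
Variables (k : nat) (f : 'I_k -> A -> U -> U) (w : 'I_k -> R).
Hypotheses (fP : dual_ifs f) (wP : open_simplex w).
Implicit Types (a b : A) (phi psi : A -> R[i]).

Lemma seminorm0 : L 0 = 0%E.
Proof.
have [_ _ LZ] := Lseminorm.
have := LZ 0 0 (cadj0 A); rewrite scale0r => ->.
by rewrite normr0 mul0e.
Qed.

Lemma state_dist_ge0 phi psi : (0 <= state_dist L phi psi)%E.
Proof.
apply: (@le_trans _ _ (rnorm (phi 0 - psi 0))%:E); first by rewrite lee_fin rnorm_ge0.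
apply: ereal_sup_ubound; exists 0 => //=; split; first exact: cadj0.
by rewrite seminorm0 lee01.
Qed.

Lemma state_distC phi psi : state_dist L phi psi = state_dist L psi phi.
Proof.
rewrite /state_dist; congr ereal_sup.
by apply: eq_imagel => b _ /=; rewrite rnormBC.
Qed.

Lemma lipschitz_constant_ge0 (x : (A -> R[i]) -> R[i]) :
  (0 <= lipschitz_constant L x)%E.
Proof.
by apply: le_ereal_inf_tmp => _ [C [C0 _] <-]; rewrite lee_fin ltW.
Qed.

Lemma dilation_ge0 g : (0 <= dilation (U := U) L g)%E.
Proof.
apply: (@le_trans _ _ (multiplier_seminorm L (g 0))).
  exact: lipschitz_constant_ge0.
apply: ereal_sup_ubound; exists 0 => //=; split; first exact: cadj0.
by rewrite seminorm0 lee01.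
Qed.

(* The slack below 1 is shared out so that every f i admits a Lipschitz
   constant strictly below some m i while the mean of the m i is still < 1. *)
Lemma dilation_bounds : (mean_dilation L w f < 1)%E ->
  exists m : 'I_k -> R, [/\ forall i, 0 < m i,
    \sum_(i < k) w i * m i < 1 &
    forall i b phi psi (r : R), selfadjoint b -> (L b <= 1)%E ->
      state phi -> state psi -> (state_dist L phi psi <= r%:E)%E ->
      rnorm (normal_ext U phi (f i b) - normal_ext U psi (f i b)) <= m i * r].
Proof.
move=> Lw; have [w01 w1] := wP.
have wi0 i : 0 < w i by have /andP[] := w01 i.
have term0 i : (0 <= (w i)%:E * dilation L (f i))%E.
  by rewrite mule_ge0 ?dilation_ge0// lee_fin ltW.
(* All weights are positive and the other terms nonnegative, so one infinite dilation would make the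
   mean infinite. *)
have fin i : dilation L (f i) \is a fin_num.
  rewrite ge0_fin_numE ?dilation_ge0// ltNge; apply/negP => dy.
  have dE : dilation L (f i) = +oo%E by apply/eqP; rewrite -leye_eq.
  move: Lw; rewrite /mean_dilation (bigD1 i)//= dE gt0_muley ?lte_fin//.
  rewrite addye ?ltNge ?leey//.
  apply/eqP => h; have : (0 <= \sum_(j < k | j != i) (w j)%:E * dilation L (f j))%E.
    by apply: sume_ge0.
  by rewrite h leeNy_eq.
pose l i := fine (dilation L (f i)).
have lE i : dilation L (f i) = (l i)%:E by rewrite fineK.
have l0 i : 0 <= l i by rewrite fine_ge0// dilation_ge0.
have lw : \sum_(i < k) w i * l i < 1.
  by move: Lw; rewrite /mean_dilation (eq_bigr (fun i => (w i * l i)%:E)) ?sumEFin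
    => [|i _]; rewrite ?lte_fin// lE.
(* Half the gap below 1: since the weights sum to 1, adding [d] to every constant raises the mean by
   [d]. *)
pose d := (1 - \sum_(i < k) w i * l i) / 2.
have d0 : 0 < d by rewrite divr_gt0// subr_gt0.
exists (fun i => l i + d); split.
- by move=> i; have := l0 i; lra.
- under eq_bigr do rewrite mulrDr; rewrite big_split/= -mulr_suml w1.
  by rewrite /d; lra.
move=> i b phi psi r bs Lb phist psist dr.
have : (multiplier_seminorm L (f i b) < (l i + d)%:E)%E.
  apply: (@le_lt_trans _ _ (l i)%:E); last by rewrite lte_fin ltrDl.
  by rewrite -lE; apply: ereal_sup_ubound; exists b.
move=> /ereal_inf_lt[_ [C [C0 CP] <-]]; rewrite lte_fin => Cl.
have r0 : 0 <= r by rewrite -lee_fin (le_trans (state_dist_ge0 phi psi)).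
rewrite -lee_fin (le_trans (CP _ _ phist psist))//.
apply: (@le_trans _ _ (C%:E * r%:E)%E).
  by rewrite lee_wpmul2l// lee_fin ltW.
by rewrite -EFinM lee_fin ler_wpM2r// ltW.
Qed.

Lemma ifs_action_contraction : (mean_dilation L w f < 1)%E ->
  exists m : R, [/\ 0 <= m, m < 1 &
    forall phi psi (r : R), state phi -> state psi ->
      (state_dist L phi psi <= r%:E)%E ->
      (state_dist L (ifs_action w f phi) (ifs_action w f psi) <= (m * r)%:E)%E].
Proof.
move=> /dilation_bounds[m [m0 mw mP]].
have w0 i : 0 <= w i by exact: simplex_ge0.
exists (\sum_(i < k) w i * m i); split=> //.
  by apply: sumr_ge0 => i _; rewrite mulr_ge0// ltW.
move=> phi psi r phist psist dr; apply: ge_ereal_sup => _ [b [bs Lb] <-].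
rewrite lee_fin /ifs_action -sumrB.
under eq_bigr do rewrite -mulrBr.
rewrite (le_trans (rnorm_comb _ w0))// mulr_suml.
by apply: ler_sum => i _; rewrite -mulrA ler_wpM2l// mP.
Qed.

Lemma state_dist_bound phi psi b (r t : R) : state phi -> state psi ->
  selfadjoint b -> 0 < t -> (L b <= t%:E)%E ->
  (state_dist L phi psi <= r%:E)%E -> rnorm (phi b - psi b) <= t * r.
Proof.
move=> phist psist bs t0 Lb dr; have [_ _ LZ] := Lseminorm.
have ti : 0 < t^-1 by rewrite invr_gt0.
have : ((rnorm (phi (t^-1%:C *: b) - psi (t^-1%:C *: b)))%:E <= r%:E)%E.
  apply: le_trans dr; apply: ereal_sup_ubound; exists (t^-1%:C *: b) => //=.
  split; first by rewrite /selfadjoint/= cadjZ conjc_real bs.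
  rewrite LZ// gtr0_norm// (@le_trans _ _ (t^-1%:E * t%:E)%E)//.
    by rewrite lee_wpmul2l// lee_fin ltW.
  by rewrite -EFinM mulVf ?gt_eqF.
rewrite !stateZ// -mulrBr rnormM rnorm_real gtr0_norm// lee_fin.
by rewrite mulrC ler_pdivrMr// mulrC.
Qed.

End Contraction.

(** * Null ideals and self-similar states *)

Section NullIdeal.
Variables (R : realType) (A : cstarType R) (U : universal_rep A).
Variables (k : nat) (f : 'I_k -> A -> U -> U).
Hypothesis fP : dual_ifs f.
Variables (D : directed) (J : D -> A).
Hypothesis JP : approximate_identity J.
Implicit Types (a b c : A) (phi psi : A -> R[i]).

(** For states, killing the cyclic vector means [phi (a^* a) = 0], so this is inclusion of the left
    null ideals, in a form that makes sense for multipliers. *)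
Definition null_dominated psi phi : Prop :=
  forall a, urep U a (uvec U phi) = 0 -> urep U a (uvec U psi) = 0.

(** Each [urep U b \o T] is some [urep U c], to which domination applies; nondegeneracy then removes
    [b]. *)
Lemma null_dominated_multiplier psi phi (T : U -> U) : null_dominated psi phi ->
  multiplier T -> T (uvec U phi) = 0 -> T (uvec U psi) = 0.
Proof.
move=> dom [_ Tm] Tphi; apply: urep_nondegenerate => b.
have [_ [c _ cE]] := Tm b.
have cb u : urep U c u = urep U b (T u) by rewrite cE.
by rewrite -cb dom// cb Tphi; apply: linear_op0; have [] := urep_bounded U b.
Qed.

(** Self-similarity under the positive [w'] makes every [f i a] kill the vector of [phi]. As
    multipliers they then kill that of [psi], whatever weights [w] are put on them. *)
Lemma null_dominated_ifs (w w' : 'I_k -> R) psi phi :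
  open_simplex w -> open_simplex w' -> state psi -> state phi ->
  self_similar w' f phi -> null_dominated psi phi ->
  null_dominated (ifs_action w f psi) phi.
Proof.
move=> wP w'P psist phist phiE dom a axi.
have w'0 i : 0 < w' i by have [/(_ i)/andP[]] := w'P.
have : \sum_(i < k) w' i * rnorm (f i a (uvec U phi)) ^+ 2 = 0.
  apply: complexI; rewrite -(ifs_action_sqr _ fP) -phiE -(gns_inner U)//.
  by rewrite axi inner0l.
move=> /psumr_eq0P sum0.
have fpsi i : f i a (uvec U psi) = 0.
  have [fhom _] := fP i; apply: (null_dominated_multiplier dom).
    by have [] := fhom.
  apply: rnorm_eq0; apply/eqP; rewrite -sqrf_eq0.
  have /eqP := sum0 (fun j _ => mulr_ge0 (ltW (w'0 j)) (sqr_ge0 _)) i isT.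
  by rewrite mulf_eq0 gt_eqF.
apply: rnorm_eq0; apply/eqP; rewrite -sqrf_eq0 gns_sqr; last first.
  exact: (ifs_action_state fP wP JP).
rewrite ifs_action_sqr//= big1// => i _.
by rewrite fpsi rnorm0 expr0n mulr0.
Qed.

End NullIdeal.

Section SelfSimilar.
Variables (R : realType) (A : cstarType R) (U : universal_rep A).
Variable L : A -> \bar R.
Hypothesis LP : extended_complete_spectral_metric_space L.
Variables (k : nat) (f : 'I_k -> A -> U -> U).
Hypothesis fP : dual_ifs f.
Implicit Types (a b c : A) (phi psi : A -> R[i]).

Lemma self_similar_null_dominated (w w' : 'I_k -> R) phi psi :
  open_simplex w -> open_simplex w' -> (mean_dilation L w f < 1)%E ->
  state phi -> state psi -> self_similar w f phi -> self_similar w' f psi ->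
  (state_dist L phi psi < +oo)%E -> null_dominated U phi psi.
Proof.
move=> wP w'P Lw phist psist phiE psiE dfin a axi.
have [Lsn Ldense [D [J [JP _]]] _] := LP.
have [m [m0 m1 mP]] := ifs_action_contraction Lsn wP Lw.
have dfin' : state_dist L phi psi \is a fin_num.
  by rewrite ge0_fin_numE// state_dist_ge0.
pose r := fine (state_dist L phi psi).
have rE : state_dist L phi psi = r%:E by rewrite fineK.
have r0 : 0 <= r by rewrite fine_ge0// state_dist_ge0.
pose psi_ n := iter n (ifs_action w f) psi.
have psist_ n : state (psi_ n) by exact: (iter_ifs_action_state fP wP JP).
have dist_ n : (state_dist L phi (psi_ n) <= (m ^+ n * r)%:E)%E.
  elim: n => [|n IH]; first by rewrite expr0 mul1r rE.
  by rewrite exprS -mulrA phiE /= mP.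
have null_ n : null_dominated U (psi_ n) psi.
  elim: n => [//|n IH]; exact: (null_dominated_ifs fP JP wP w'P).
(* The seminorm controls self-adjoint elements only, so the limit is taken at [a^* a]. *)
set c := cmul (cadj a) a.
have cs : selfadjoint c by exact: selfadjoint_sqr.
have psic n : psi_ n c = 0 by rewrite -(gns_inner U)// null_// inner0l.
suff phic : phi c = 0.
  by apply: rnorm_eq0; apply/eqP; rewrite -sqrf_eq0 gns_sqr// -/c phic.
(* Three errors: [phi c - phi b], [phi b - psi_ n b], and [psi_ n b], the last small because
   [psi_ n c = 0]. *)
apply: rnorm_small => e e0; have e30 : 0 < e / 3 by rewrite divr_gt0.
have [b [[bs Lb] /= cb]] := Ldense _ cs _ (near_rnorm c e30).
have L0 : (0 <= L b)%E by have [/(_ b bs)] := Lsn.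
have Lfin : L b \is a fin_num by rewrite ge0_fin_numE.
(* Adding 1 keeps the scaling factor positive when [L b = 0]. *)
pose t := fine (L b) + 1.
have t0 : 0 < t by rewrite ltr_pwDr// fine_ge0.
have Lt : (L b <= t%:E)%E by rewrite -(fineK Lfin) lee_fin lerDl.
have tr0 : 0 < t * r + 1 by rewrite ltr_pwDr// mulr_ge0// ltW.
have : `|m| < 1 by rewrite ger0_norm.
move=> /(cvg_geometric 1)/cvgrPdist_lt/(_ _ (divr_gt0 e30 tr0))[n _ nP].
have := nP n (leqnn n); rewrite /= sub0r normrN mul1r ger0_norm ?exprn_ge0//.
rewrite ltr_pdivlMr// => mn.
have := state_dist_bound Lsn phist (psist_ n) bs t0 Lt (dist_ n).
have := state_le (c - b) phist; have := state_le (c - b) (psist_ n).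
rewrite !stateB// psic => h1 h2 h3.
have := rnormD (phi c - phi b) (phi b - psi_ n b); rewrite addrA addrNK.
have := rnormD (phi c - psi_ n b) (psi_ n b); rewrite addrNK.
rewrite sub0r rnormN in h1.
have : 0 <= m ^+ n by rewrite exprn_ge0.
nra.
Qed.

(** Test with the sequence [u, 0, 0, ...]: the partial sums are constant from index 1 on. *)
Lemma sigma_weak_inner (D : directed) (T : D -> U -> U) (S : U -> U) u :
  sigma_weak_cvg T S ->
  forall e : R, 0 < e -> \forall d \near tails D,
    rnorm (inner (T d u - S u) u) < e.
Proof.
move=> TS e e0; pose xi n := if n is 0%N then u else 0.
have sumE (V : zmodType) (g : nat -> V) : (forall n, g n.+1 = 0) ->
    \forall n \near \oo, series g n = g 0%N.
  move=> g0; exists 1%N => // -[//|n] _.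
  by rewrite /series/= big_nat_recl// big1 ?addr0// => i _.
have xis : square_summable xi.
  apply: (is_cvg_near_cst (rnorm u ^+ 2)); apply: sumE => n /=.
  by rewrite rnorm0 expr0n.
have /cvg_rnormP/(_ e e0) := TS xi xi xis xis.
apply: filterS => d; rewrite sub0r rnormN.
rewrite (@lim_near_cst R[i]^o _ _ _ _ (inner (T d u - S u) u))//.
apply: (sumE _ (fun n => inner (T d (xi n) - S (xi n)) (xi n) : R[i]^o)) => n /=.
by rewrite inner0r.
Qed.

Lemma closed_projection_dominated phi psi s :
  rnorm (uvec U phi) = 1 -> rnorm (uvec U psi) = 1 -> null_dominated U phi psi ->
  closed_projection s -> normal_ext U psi s = 1 -> normal_ext U phi s = 1.
Proof.
move=> xi1 xi1' dom [sP [_ [D [x [xpos xinc xs]]]]] /(normal_ext_projection sP xi1') spsi.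
have cvg u (e : R) : 0 < e -> \forall d \near tails D,
    rnorm (inner (urep U (x d) u - (u - s u)) u) < e.
  by move=> e0; exact: (sigma_weak_inner u xs e0).
have inc d d' u : dle d d' ->
    Re (inner (urep U (x d) u) u) <= Re (inner (urep U (x d') u) u).
  move=> /xinc /(positive_ge0 u).
  rewrite (star_repB (@urep_linear _ _ U)) innerBl subr_ge0 lecE.
  by case/andP.
(* At the vector of [psi] the nonnegative forms of [x d] increase to that of [1 - s], which is 0, so
   all vanish. With [x d = c^* c], [c] kills that vector, and by [dom] that of [phi]. *)
have xphi d : inner (urep U (x d) (uvec U phi)) (uvec U phi) = 0.
  have [c cE] := xpos d.
  have sqrE u : inner (urep U (x d) u) u = (rnorm (urep U c u) ^+ 2)%:C.
    by rewrite cE urepM/= urep_adj cadjK inner_rnorm.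
  rewrite sqrE dom ?rnorm0 ?expr0n//.
  apply: rnorm_eq0; apply/eqP; rewrite -sqrf_eq0 eq_le sqr_ge0 andbT.
  apply/ler_addgt0Pr => e e0; rewrite add0r.
  have dd' : \forall d' \near tails D, dle d d' by exists d.
  have [d' [/= h1 h2]] := filter_ex (filterI dd' (cvg (uvec U psi) e e0)).
  have := inc _ _ (uvec U psi) h1; rewrite sqrE /= => h3.
  rewrite spsi subrr subr0 in h2.
  exact: le_trans h3 (le_trans (Re_le_rnorm _) (ltW h2)).
have : inner (uvec U phi - s (uvec U phi)) (uvec U phi) = 0.
  apply: rnorm_small => e e0.
  have [d /= /ltW] := filter_ex (cvg (uvec U phi) e e0).
  by rewrite innerBl xphi sub0r rnormN.
rewrite innerBl => /eqP; rewrite subr_eq0 /normal_ext => /eqP <-.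
by rewrite inner_rnorm xi1 expr1n.
Qed.

End SelfSimilar.

Theorem theorem4p4 (R : realType) (A : cstarType R) (U : universal_rep A)
  (L : A -> \bar R) (k : nat) (f : 'I_k -> A -> U -> U)
  (w w' : 'I_k -> R) (phi phi' : A -> R[i]) :
  extended_complete_spectral_metric_space L ->
  metric_determines_seminorm L ->
  dual_ifs f ->
  open_simplex w -> open_simplex w' ->
  (mean_dilation L w f < 1)%E -> (mean_dilation L w' f < 1)%E ->
  state phi -> state phi' ->
  self_similar w f phi -> self_similar w' f phi' ->
  (state_dist L phi phi' < +oo)%E ->
  closed_supp U phi = closed_supp U phi'.
Proof.
move=> LP _ fP wP w'P Lw Lw' phist phi'st phiE phi'E dfin.
have [Lsn _ [D [J [JP _]]] _] := LP.
have xi1 := state_vector_norm U JP phist.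
have xi1' := state_vector_norm U JP phi'st.
have dom := self_similar_null_dominated LP fP wP w'P Lw phist phi'st phiE phi'E dfin.
rewrite state_distC in dfin.
have dom' := self_similar_null_dominated LP fP w'P wP Lw' phi'st phist phi'E phiE dfin.
apply: closed_supp_eq => // s sc.
by split; apply: closed_projection_dominated.
Qed.
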